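(* Let $\mathcal L$ and $\mathcal C$ be languages such that $\mathcal L\cap\mathcal C=\varnothing$ and each $\mathcal C_\alpha$ ($\alpha\in\mathcal T$) is denumerably infinite. Assume that $\mathcal P$ is a sound provability property in $\mathcal L\cup\mathcal C$ and that $\Gamma$ is a sequent in the language $\mathcal L$. If $\Gamma\notin\mathcal P$, then $\Gamma$ is refuted by a countable normal intensional model.
   Context: **Syntax.** Fix a finite set $\mathcal B$ of basic types. The set $\mathcal T$ of types is the smallest set of strings with $\mathcal B\subseteq\mathcal T$ and $\langle\alpha_1\ldots\alpha_n\rangle\in\mathcal T$ whenever $\alpha_1,\ldots,\alpha_n\in\mathcal T$ ($n\ge 0$). Types $\langle\alpha_1\ldots\alpha_n\rangle$ (including $\langle\rangle$) are called complex. A language is a countable set $\mathcal L$ of uniquely typed (non-logical) constants; $\mathcal L_\alpha$ is the set of its constants of type $\alpha$. For each type $\alpha$ there is a denumerably infinite set $\mathcal V_\alpha$ of variables with unique type $\alpha$; $\mathcal V=\bigcup_\alpha\mathcal V_\alpha$. The sets $T^{\mathcal L}_\alpha$ of terms of $\mathcal L$ of type $\alpha$ are given inductively: $\mathcal L_\alpha,\mathcal V_\alpha\subseteq T^{\mathcal L}_\alpha$; $\bot\in T^{\mathcal L}_{\langle\rangle}$; if $A\in T^{\mathcal L}_{\langle\alpha_1\alpha_2\ldots\alpha_n\rangle}$ and $B\in T^{\mathcal L}_{\alpha_1}$ then $(AB)\in T^{\mathcal L}_{\langle\alpha_2\ldots\alpha_n\rangle}$; if $A\in T^{\mathcal L}_{\langle\alpha_2\ldots\alpha_n\rangle}$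 and $x\in\mathcal V_{\alpha_1}$ then $(\lambda x.A)\in T^{\mathcal L}_{\langle\alpha_1\alpha_2\ldots\alpha_n\rangle}$; if $A,B\in T^{\mathcal L}_\alpha$ with $\alpha$ complex then $(A\subset B)\in T^{\mathcal L}_{\langle\rangle}$. $T^{\mathcal L}=\bigcup_\alpha T^{\mathcal L}_\alpha$. Terms of type $\langle\rangle$ are formulas; closed formulas are sentences. Application associates to the left. $A\{x:=B\}$ is substitution of $B$ for the free occurrences of $x$ in $A$; ''$B$ is free for $x$ in $A$'' has its usual meaning (no variable capture). Terms are not identified up to $\alpha$-conversion. Abbreviations: $\varphi\to\psi$ is $\varphi\subset\psi$ for formulas; $\top$ is $\bot\to\bot$; $\forall x\varphi$ is $(\lambda x.\top)\subset(\lambda x.\varphi)$; for $A,B$ of type $\alpha$, $A=B$ is $\forall x(xA\to xB)$ with $x$ a variable of type $\langle\alpha\rangle$ not free in $A,B$. **Intensional models.** A collection of domains is a family $D=\{D_\alpha\mid\alpha\in\mathcal T\}$ of pairwise disjoint non-empty sets. An assignment for $D$ is a function $a$ on $\mathcal V$ with $a(x)\in D_\alpha$ for $x\in\mathcal V_\alpha$; $\mathcal A_D$ is the set of assignments; $a[d/x]$ is $a$ changed to send $x$ to $d$. An intension function for $D$ and $\mathcal L$ is a function $I$ from $\mathcal A_D\times T^{\mathcal L}$ to $\bigcup_\alpha D_\alpha$ such that: (1) $I(a,A)\in D_\alpha$ if $A$ has type $\alpha$; (2) $I(a,x)=a(x)$ for variables $x$; (3) $I(a,A)=I(a',A)$ if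 $a,a'$ agree on all variables free in $A$; (4) $I(a,A\{x:=B\})=I(a[I(a,B)/x],A)$ if $B$ is free for $x$ in $A$. An extension function for $D$ is a function $E$ with domain $\bigcup\{D_\alpha\mid\alpha\text{ complex}\}$ such that $E(d)\subseteq D_{\alpha_1}\times\cdots\times D_{\alpha_n}$ whenever $d\in D_{\langle\alpha_1\ldots\alpha_n\rangle}$. For $n=0$ the product is $\{\langle\rangle\}$; write $0=\varnothing$ and $1=\{\langle\rangle\}$, so $E$ maps $D_{\langle\rangle}$ to $\{0,1\}$. Put $V(a,A)=E(I(a,A))$ for $A$ of complex type. A triple $M=\langle D,I,E\rangle$ of such objects is an intensional model for $\mathcal L$ if for all $a$ and all terms of $\mathcal L$ of appropriate types: (1) $V(a,\bot)=0$; (2) $V(a,AB)=\{\langle\vec d\rangle\mid\langle I(a,B),\vec d\rangle\in V(a,A)\}$; (3) $V(a,\lambda x_\beta.A)=\{\langle d,\vec d\rangle\mid d\in D_\beta\text{ and }\langle\vec d\rangle\in V(a[d/x],A)\}$; (4) $V(a,A\subset B)=1$ iff $V(a,A)\subseteq V(a,B)$. For a sentence $\varphi$, $M\models\varphi$ means $V(a,\varphi)=1$ for some (equivalently, any) assignment $a$. $M$ is normal if for every type $\alpha$, all $d,d'\in D_\alpha$ and any $a$: $\langle d,d'\rangle\in V(a,\lambda x_\alpha\lambda x'_\alpha.x=x')$ implies $d=d'$. $M$ is countable if every $D_\alpha$ is countable. **Sequents.** A sequent of $\mathcal L$ is a (finite or infinite) set of signed sentences $\mathsf L\colon\varphi$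 or $\mathsf R\colon\varphi$ with $\varphi$ a sentence of $\mathcal L$. For sets $\Pi,\Sigma$ of sentences, $\Pi\Rightarrow\Sigma$ denotes $\{\mathsf L\colon\varphi\mid\varphi\in\Pi\}\cup\{\mathsf R\colon\varphi\mid\varphi\in\Sigma\}$; $\Pi,\varphi$ means $\Pi\cup\{\varphi\}$. An intensional model $M$ for $\mathcal L$ refutes $\Pi\Rightarrow\Sigma$ if $M\models\varphi$ for all $\varphi\in\Pi$ and $M\not\models\varphi$ for all $\varphi\in\Sigma$. **Sequent rules** (premises / conclusion; all formulas displayed are sentences, $\vec C$ is a sequence of closed terms of appropriate types, possibly empty): - $[W]$: $\Pi\Rightarrow\Sigma\ /\ \Pi'\Rightarrow\Sigma'$, if $\Pi\subseteq\Pi'$ and $\Sigma\subseteq\Sigma'$. - $[R]$: (no premise) $/\ \Pi,\varphi\Rightarrow\Sigma,\varphi$. - $[\bot\mathsf L]$: (no premise) $/\ \Pi,\bot\Rightarrow\Sigma$. - $[\lambda\mathsf L]$: $\Pi,A\{x:=B\}\vec C\Rightarrow\Sigma\ /\ \Pi,(\lambda x.A)B\vec C\Rightarrow\Sigma$, if $B$ is free for $x$ in $A$. - $[\lambda\mathsf R]$: $\Pi\Rightarrow\Sigma,A\{x:=B\}\vec C\ /\ \Pi\Rightarrow\Sigma,(\lambda x.A)B\vec C$, if $B$ is free for $x$ in $A$. - $[\subset\mathsf L]$: $\Pi,B\vec C\Rightarrow\Sigma$ and $\Pi\Rightarrow\Sigma,A\vec C\ /\ \Pi,A\subset B\Rightarrow\Sigma$.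 - $[\subset\mathsf R]$: $\Pi,A\vec c\Rightarrow\Sigma,B\vec c\ /\ \Pi\Rightarrow\Sigma,A\subset B$, if the constants $\vec c$ are fresh (pairwise distinct and not occurring in the conclusion). **Provability properties.** A set $\mathcal P$ of sequents in a language is a provability property in that language if it is closed under the sequent rules (with sequents, terms and constants of that language): $\Gamma\in\mathcal P$ whenever $\{\Gamma_1,\ldots,\Gamma_n\}\subseteq\mathcal P$ ($n\ge 0$) and $\Gamma_1,\ldots,\Gamma_n/\Gamma$ is an instance of a sequent rule. It is sound if no $\Gamma\in\mathcal P$ is refuted by an intensional model for that language. *)

(* Defs.v *)
From Stdlib Require List.
From HB Require Import structures.
From mathcomp Require Import all_boot.
From mathcomp Require Import boolp classical_sets functions cardinality.

Set Implicit Arguments.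
Unset Strict Implicit.
Unset Printing Implicit Defensive.

Local Open Scope classical_set_scope.
Local Open Scope card_scope.

(* [Complex [:: a1; ...; an]] is the type <a1 ... an>. *)
Inductive ty (B : Type) : Type :=
| Basic of B
| Complex of seq (ty B).
Arguments Complex {B}.

Section TyCount.
Variable B : finType.

Fixpoint ty_encode (t : ty B) : GenTree.tree B :=
  match t with
  | Basic b => GenTree.Leaf b
  | Complex ts => GenTree.Node 0 (map ty_encode ts)
  end.

Fixpoint ty_decode (t : GenTree.tree B) : ty B :=
  match t with
  | GenTree.Leaf b => Basic b
  | GenTree.Node _ ts => Complex (map ty_decode ts)
  end.

Lemma ty_encodeK : cancel ty_encode ty_decode.
Proof.
rewrite /cancel; fix IH 1; case=> [b|ts] //=; congr Complex.
by elim: ts => [|t ts IHts] //=; rewrite IH IHts.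
Qed.

HB.instance Definition _ := Countable.copy (ty B) (can_type ty_encodeK).

End TyCount.

(* [prods F [:: a1; ...; an]] is F a1 * (... * (F an * unit)); the empty tuple
   is [tt]. *)
Fixpoint prods (B : Type) (F : ty B -> Type) (ts : seq (ty B)) : Type :=
  match ts with
  | [::] => unit
  | t :: ts' => (F t * prods F ts')%type
  end.

Section Syntax.

Variable B : finType.

(* A pool of typed symbols: [K t] are the symbols of type [t].  A language is a
   countable set of typed symbols, so that unions and intersections of
   languages are those of sets, and types are unique by construction. *)
Variable K : ty B -> Type.

Definition const := {t : ty B & K t}.

Definition consts_of (L : set const) (t : ty B) : set (K t) :=
  [set c | L (Tagged K c)].

(* The variables of type [t] are the pairs [(t, n)] with [n : nat]. *)
Definition var := (ty B * nat)%type.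

(* Terms over the whole pool; those of a language [L] are singled out by
   [in_lang L] below. *)
Inductive term : ty B -> Type :=
| Con t (c : K t) : term t
| Var (x : var) : term x.1
| Bot : term (Complex [::])
| App t ts (M : term (Complex (t :: ts))) (N : term t) : term (Complex ts)
| Lam (x : var) ts (M : term (Complex ts)) : term (Complex (x.1 :: ts))
| Incl ts (M N : term (Complex ts)) : term (Complex [::]).

Definition formula := term (Complex [::]).

Fixpoint free (x : var) t (M : term t) : bool :=
  match M with
  | Con _ _ => false
  | Var y => y == x
  | Bot => false
  | App _ _ M N => free x M || free x N
  | Lam y _ M => (y != x) && free x M
  | Incl _ M N => free x M || free x N
  end.

Definition closed t (M : term t) : Prop := forall x, ~~ free x M.

Fixpoint consts t (M : term t) : set const :=
  match M with
  | Con t c => [set Tagged K c]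
  | Var _ => set0
  | Bot => set0
  | App _ _ M N => consts M `|` consts N
  | Lam _ _ M => consts M
  | Incl _ M N => consts M `|` consts N
  end.

Definition in_lang (L : set const) t (M : term t) : Prop := consts M `<=` L.

(* Capturing substitution M{x := N}: bound variables are never renamed. *)
Fixpoint subst (x : var) (N : term x.1) t (M : term t) : term t :=
  match M with
  | Con _ c => Con c
  | Var y => @dfwith var (fun z => term z.1) Var x N y
  | Bot => Bot
  | App _ _ M1 M2 => App (subst N M1) (subst N M2)
  | Lam y _ M1 => if y == x then Lam y M1 else Lam y (subst N M1)
  | Incl _ M1 M2 => Incl (subst N M1) (subst N M2)
  end.

Fixpoint free_for s (N : term s) (x : var) t (M : term t) : bool :=
  match M with
  | Con _ _ => true
  | Var _ => true
  | Bot => true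
  | App _ _ M1 M2 => free_for N x M1 && free_for N x M2
  | Lam y _ M1 => free x (Lam y M1) ==> ~~ free y N && free_for N x M1
  | Incl _ M1 M2 => free_for N x M1 && free_for N x M2
  end.

Definition Imp (f g : formula) : formula := Incl f g.
Definition Top : formula := Imp Bot Bot.
Definition All (x : var) (f : formula) : formula := Incl (Lam x Top) (Lam x f).

(* M = N, with the variable of type <t> and index [n] as the bound variable;
   that variable must not be free in M and N. *)
Definition Eqt (n : nat) t (M N : term t) : formula :=
  let y : var := (Complex [:: t], n) in
  All y (Imp (App (Var y) M) (App (Var y) N)).

Fixpoint apps ts : term (Complex ts) -> prods term ts -> formula :=
  match ts with
  | [::] => fun M _ => M
  | t :: ts' => fun M Ns => apps (App M Ns.1) Ns.2
  end.

Fixpoint con_terms ts : prods K ts -> prods term ts :=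
  match ts with
  | [::] => fun _ => tt
  | t :: ts' => fun cs => (Con cs.1, con_terms cs.2)
  end.

Fixpoint con_list ts : prods K ts -> seq const :=
  match ts with
  | [::] => fun _ => [::]
  | t :: ts' => fun cs => Tagged K cs.1 :: con_list cs.2
  end.

Definition sentence (L : set const) (f : formula) : Prop :=
  closed f /\ in_lang L f.

Inductive signed : Type :=
| Lsign of formula
| Rsign of formula.

Definition unsign (s : signed) : formula :=
  match s with Lsign f => f | Rsign f => f end.

Definition sequent := set signed.

Definition seqt (Pi Sigma : set formula) : sequent :=
  (Lsign @` Pi) `|` (Rsign @` Sigma).

Definition sequent_of (L : set const) : set sequent :=
  [set G | forall s, G s -> sentence L (unsign s)].

Definition sconsts (G : sequent) : set const :=
  \bigcup_(s in G) consts (unsign s).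

(* [rule Gs G]: G follows from the premises Gs.  That only sentences of the
   language at hand occur is imposed in [rule_instance]. *)
Inductive rule : set sequent -> sequent -> Prop :=
| rule_W Pi Sigma Pi' Sigma' :
    Pi `<=` Pi' -> Sigma `<=` Sigma' ->
    rule [set seqt Pi Sigma] (seqt Pi' Sigma')
| rule_R Pi Sigma f :
    rule set0 (seqt (Pi `|` [set f]) (Sigma `|` [set f]))
| rule_BotL Pi Sigma :
    rule set0 (seqt (Pi `|` [set Bot]) Sigma)
| rule_LamL Pi Sigma (x : var) ts (M : term (Complex ts)) (N : term x.1)
    (Cs : prods term ts) :
    free_for N x M ->
    rule [set seqt (Pi `|` [set apps (subst N M) Cs]) Sigma]
         (seqt (Pi `|` [set apps (App (Lam x M) N) Cs]) Sigma)
| rule_LamR Pi Sigma (x : var) ts (M : term (Complex ts)) (N : term x.1)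
    (Cs : prods term ts) :
    free_for N x M ->
    rule [set seqt Pi (Sigma `|` [set apps (subst N M) Cs])]
         (seqt Pi (Sigma `|` [set apps (App (Lam x M) N) Cs]))
| rule_InclL Pi Sigma ts (M N : term (Complex ts)) (Cs : prods term ts) :
    rule [set seqt (Pi `|` [set apps N Cs]) Sigma;
              seqt Pi (Sigma `|` [set apps M Cs])]
         (seqt (Pi `|` [set Incl M N]) Sigma)
| rule_InclR Pi Sigma ts (M N : term (Complex ts)) (cs : prods K ts) :
    List.NoDup (con_list cs) ->
    (forall c, List.In c (con_list cs) ->
       ~ sconsts (seqt Pi (Sigma `|` [set Incl M N])) c) ->
    rule [set seqt (Pi `|` [set apps M (con_terms cs)])
                   (Sigma `|` [set apps N (con_terms cs)])]
         (seqt Pi (Sigma `|` [set Incl M N])).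

Definition rule_instance (L : set const) (Gs : set sequent) (G : sequent) :=
  [/\ rule Gs G, Gs `<=` sequent_of L & sequent_of L G].

Definition provability_property (L : set const) (P : set sequent) : Prop :=
  P `<=` sequent_of L /\
  forall Gs G, rule_instance L Gs G -> Gs `<=` P -> P G.

End Syntax.

Arguments consts_of {B K} L t.

Section Models.

Variables (B : finType) (K : ty B -> Type).

(* Pairwise disjointness of the domains is built into indexing them by types. *)
Definition assignment (D : ty B -> Type) := forall x : var B, D x.1.

(* a[d/x] *)
Definition update (D : ty B -> Type) (a : assignment D) (x : var B)
    (d : D x.1) : assignment D :=
  @dfwith (var B) (fun y => D y.1) a x d.

(* [I] is total on the terms over the pool; outside the terms of L its values
   are arbitrary. *)
Record intension_function (L : set (const K)) (D : ty B -> Type)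
    (I : assignment D -> forall t, term K t -> D t) : Prop := {
  int_var : forall a x, I a _ (Var K x) = a x;
  int_free : forall a a' t (M : term K t), in_lang L M ->
    (forall x, free x M -> a x = a' x) -> I a t M = I a' t M;
  int_subst : forall a t (M : term K t) (x : var B) (N : term K x.1),
    in_lang L M -> in_lang L N -> free_for N x M ->
    I a t (subst N M) = I (update a (I a _ N)) t M
}.

(* The extension of an element of D_<> is a subset of [unit]; the truth values
   0 and 1 are [set0] and [[set tt]]. *)
Record structure : Type := {
  dom :> ty B -> Type;
  dom_nonempty : forall t, inhabited (dom t);
  intn : assignment dom -> forall t, term K t -> dom t;
  ext : forall ts, dom (Complex ts) -> set (prods dom ts)
}.

(* V(a, A) = E(I(a, A)) *)
Definition value (M : structure) (a : assignment M) ts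
    (A : term K (Complex ts)) : set (prods M ts) :=
  ext (intn a A).

Record intensional_model (L : set (const K)) (M : structure) : Prop := {
  model_intn : intension_function L (@intn M);
  value_Bot : forall a : assignment M, value a (Bot K) = set0;
  value_App : forall (a : assignment M) t ts
      (A : term K (Complex (t :: ts))) (A' : term K t),
    in_lang L A -> in_lang L A' ->
    value a (App A A') = [set ds | value a A (intn a A', ds)];
  value_Lam : forall (a : assignment M) (x : var B) ts
      (A : term K (Complex ts)),
    in_lang L A ->
    value a (Lam x A) = [set ds | value (update a ds.1) A ds.2];
  value_Incl : forall (a : assignment M) ts (A A' : term K (Complex ts)),
    in_lang L A -> in_lang L A' ->
    value a (Incl A A') = [set tt] <-> value a A `<=` value a A'
}.

Definition satisfies (M : structure) (f : formula K) : Prop :=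
  exists a : assignment M, value a f = [set tt].

Definition refutes (M : structure) (G : sequent K) : Prop :=
  (forall f, G (Lsign f) -> satisfies M f) /\
  (forall f, G (Rsign f) -> ~ satisfies M f).

(* The bound variables x, x' and the one hidden in x = x' are arbitrary; the
   latter has type <t>, so it is never free in x or x'. *)
Definition normal (M : structure) : Prop :=
  forall (t : ty B) (d d' : M t) (a : assignment M) (n n' m : nat), n <> n' ->
  let x : var B := (t, n) in let x' : var B := (t, n') in
  value a (Lam x (Lam x' (Eqt m (Var K x) (Var K x')))) (d, (d', tt)) ->
  d = d'.

(* At most countable domains; finite ones are allowed. *)
Definition countable_model (M : structure) : Prop :=
  forall t, countable [set: M t].

Definition sound (L : set (const K)) (P : set (sequent K)) : Prop :=
  forall G, P G ->
    ~ exists M : structure, intensional_model L M /\ refutes M G.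

End Models.

(* Main.v *)
Require Import Defs.
From mathcomp Require Import all_boot.
From mathcomp Require Import boolp classical_sets functions cardinality.
Import Defs.

Set Implicit Arguments.
Unset Strict Implicit.
Unset Printing Implicit Defensive.

Local Open Scope classical_set_scope.
Local Open Scope card_scope.

(** Cut is not among the rules, so a refuting model cannot be read off a
    complete consistent theory. The proof first builds a large model from a
    set of signed sentences that is only saturated downwards, and then shrinks
    that model.

    Saturation. All signed sentences of [L `|` C] are visited in turn; each is
    added to the sequent unless the result is provable, and [R: A ⊂ B] is added
    together with [L: A c] and [R: B c] for fresh constants [c]. Such constants
    exist because every stage uses only finitely many constants of [C]. The
    union of the stages may itself be provable, as provability need not be
    compact; but each condition of a Hintikka set involves finitely many stages
    and can be checked, after weakening, at a single one ([limit_hintikka]).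

    Possible values. A Hintikka set [H] leaves sentences undecided, so closed
    terms alone do not determine extensions. As in the Takahashi-Prawitz proof
    of cut elimination, an element of a complex type is a pair of a closed term
    [A] and any set [X] of tuples that respects [H]: tuples [d] with [L: A d]
    in [H] belong to [X], and those with [R: A d] in [H] do not. A term denotes
    its closed instance paired with the set given by the truth clauses, and the
    conditions on [H] say precisely that such a pair respects [H]
    ([pvalue_admissible]). Since intensions keep the syntax, elements with equal
    extensions may differ, and these pairs already form an intensional model,
    which refutes [H] ([possible_model], [possible_refutes]).

    Shrinking. The domains of this model are in general uncountable, and it
    need not be normal. In every intensional model Leibniz equality is a congruence,
    because the properties that express this are denoted by lambda terms
    ([leibniz_intn], [leibniz_ext]). The values generated from default elements
    by all terms and by counterexamples to false inclusions form a countable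
    family; by the Tarski-Vaught argument the inclusions true in it are those
    true in the model ([hull_Incl]). Dividing that family by the Leibniz
    equality of the large model preserves truth ([quotient_value]), and since
    truth is preserved, Leibniz equality in the quotient is identity. *)

(** * Assignments *)

Section Update.
Variables (B : finType) (D : ty B -> Type).
Implicit Types (a : assignment D) (x y : var B).

Lemma update_same a x (d : D x.1) : update a d x = d.
Proof. exact: (@dfwith_in (var B)). Qed.

Lemma update_other a x y (d : D x.1) : x != y -> update a d y = a y.
Proof. exact: (@dfwith_out (var B)). Qed.

Lemma update_id a x : update a (a x) = a.
Proof.
apply: functional_extensionality_dep => y.
have [<-|ne] := eqVneq x y; first by rewrite update_same.
by rewrite update_other.
Qed.

Lemma update_update a x (d d' : D x.1) : update (update a d) d' = update a d'.
Proof.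
apply: functional_extensionality_dep => y.
have [<-|ne] := eqVneq x y; first by rewrite !update_same.
by rewrite !update_other.
Qed.

Lemma update_swap a x y (d : D x.1) (e : D y.1) : x != y ->
  update (update a d) e = update (update a e) d.
Proof.
move=> ne; apply: functional_extensionality_dep => z.
have [yz|nyz] := eqVneq y z.
  by subst z; rewrite update_same update_other // update_same.
have [xz|nxz] := eqVneq x z.
  by subst z; rewrite update_other // !update_same.
by rewrite !update_other.
Qed.

End Update.

Lemma map_update (B : finType) (D D' : ty B -> Type) (f : forall t, D t -> D' t)
    (a : assignment D) (x : var B) (d : D x.1) :
  (fun y => f y.1 (update a d y)) = update (fun y => f y.1 (a y)) (f x.1 d).
Proof.
apply: functional_extensionality_dep => y.
have [<-|ne] := eqVneq x y; first by rewrite !update_same.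
by rewrite !update_other.
Qed.

(** * Parallel substitution *)
Section Substitution.
Variables (B : finType) (K : ty B -> Type).
Implicit Types (x y z : var B) (t : ty B) (ts : seq (ty B)).

Fixpoint fv t (M : term K t) : seq (var B) :=
  match M with
  | Con _ _ => [::]
  | Var x => [:: x]
  | Bot => [::]
  | App _ _ M N => fv M ++ fv N
  | Lam x _ M => [seq y <- fv M | x != y]
  | Incl _ M N => fv M ++ fv N
  end.

Lemma mem_fv x t (M : term K t) : free x M = (x \in fv M).
Proof.
elim: M => //= [y|? ? M -> N ->|y ts M ->|? M -> N ->].
- by rewrite inE eq_sym.
- by rewrite mem_cat.
- by rewrite mem_filter.
- by rewrite mem_cat.
Qed.

(** A substitution is an assignment in the family of the sets of terms. Bound
    variables are not renamed; no capture arises for the substitutions used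
    below, which send a variable to a closed term or to itself. *)
Fixpoint psub (s : assignment (term K)) t (M : term K t) : term K t :=
  match M with
  | Con _ c => Con c
  | Var x => s x
  | Bot => Bot K
  | App _ _ M N => App (psub s M) (psub s N)
  | Lam x _ M => Lam x (psub (update s (Var K x)) M)
  | Incl _ M N => Incl (psub s M) (psub s N)
  end.

Lemma psub_agree s s' t (M : term K t) :
  (forall x, free x M -> s x = s' x) -> psub s M = psub s' M.
Proof.
elim: M s s' => //= [x|? ? M IHM N IHN|x ts M IHM|? M IHM N IHN] s s' H.
- exact/H/eqxx.
- by rewrite (IHM s s') ?(IHN s s') // => x Hx; apply: H; rewrite Hx ?orbT.
- congr Lam; apply: IHM => y Hy.
  have [<-|ne] := eqVneq x y; first by rewrite !update_same.
  by rewrite !update_other // H // ne.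
- by rewrite (IHM s s') ?(IHN s s') // => x Hx; apply: H; rewrite Hx ?orbT.
Qed.

Lemma psub_Var t (M : term K t) : psub (Var K) M = M.
Proof. by elim: M => //= [? ? M -> N ->|x ts M|? M -> N ->] //;
  rewrite update_id => ->. Qed.

Lemma psub_closed s t (M : term K t) : closed M -> psub s M = M.
Proof.
move=> cM; rewrite -[RHS]psub_Var; apply: psub_agree => x.
by rewrite (negbTE (cM x)).
Qed.

Lemma free_psub s y t (M : term K t) :
  free y (psub s M) -> exists2 x, free x M & free y (s x).
Proof.
elim: M s => //= [x|? ? M IHM N IHN|x ts M IHM|? M IHM N IHN] s.
- by move=> H; exists x.
- by case/orP => [/IHM|/IHN] [x Hx Hs]; exists x; rewrite ?Hx ?orbT.
- case/andP=> ne /IHM [z Hz].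
  have [<-|nxz] := eqVneq x z; first by rewrite update_same /= (negbTE ne).
  by rewrite update_other // => Hs; exists z; rewrite ?nxz.
- by case/orP => [/IHM|/IHN] [x Hx Hs]; exists x; rewrite ?Hx ?orbT.
Qed.

Lemma in_lang_App (L : set (const K)) t ts (M : term K (Complex (t :: ts))) N :
  in_lang L (App M N) <-> in_lang L M /\ in_lang L N.
Proof. by rewrite /in_lang /= subUset. Qed.

Lemma in_lang_Incl (L : set (const K)) ts (M N : term K (Complex ts)) :
  in_lang L (Incl M N) <-> in_lang L M /\ in_lang L N.
Proof. by rewrite /in_lang /= subUset. Qed.

Lemma in_lang_psub (L : set (const K)) s t (M : term K t) :
  in_lang L M -> (forall x, in_lang L (s x)) -> in_lang L (psub s M).
Proof.
elim: M s => //= [? ? M IHM N IHN|x ts M IHM|? M IHM N IHN] s.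
- move=> /in_lang_App[HM HN] Hs; apply/in_lang_App; split; [exact: IHM|exact: IHN].
- move=> HM Hs; apply: IHM => // y.
  have [<-|ne] := eqVneq x y; first by rewrite update_same.
  by rewrite update_other.
- move=> /in_lang_Incl[HM HN] Hs; apply/in_lang_Incl; split;
    [exact: IHM|exact: IHN].
Qed.

Lemma subst_Var_same x (N : term K x.1) : subst N (Var K x) = N.
Proof. exact: (update_same (D := term K)). Qed.

Lemma subst_Var_other x y (N : term K x.1) :
  x != y -> subst N (Var K y) = Var K y.
Proof. exact: (update_other (D := term K)). Qed.

Lemma subst_notfree x (N : term K x.1) t (M : term K t) :
  ~~ free x M -> subst N M = M.
Proof.
elim: M => //= [y|? ? M IHM M' IHM'|y ts M IHM|? M IHM M' IHM'].
- by move=> ne; apply: (update_other (D := term K)); rewrite eq_sym.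
- by rewrite negb_or => /andP[/IHM -> /IHM' ->].
- by have [//|ne /= /IHM ->] := eqVneq y x.
- by rewrite negb_or => /andP[/IHM -> /IHM' ->].
Qed.

(** Below a binder of [x] itself the outer substitution stops, while the inner
    one goes on; the two sides agree there because [s z] cannot contain [x]
    unless [z] is [x]. *)
Lemma subst_psub s x (N : term K x.1) t (M : term K t) :
  (forall z, closed (s z) \/ s z = Var K z) ->
  subst N (psub s M) = psub (fun z => subst N (s z)) M.
Proof.
elim: M s => //= [? ? M IHM N' IHN|y ts M IHM|? M IHM N' IHN] s Hs.
- by rewrite IHM ?IHN.
- have Hs' z : closed (update s (Var K y) z) \/ update s (Var K y) z = Var K z.
    have [<-|ne] := eqVneq y z; first by right; rewrite update_same.
    by rewrite update_other.
  have [eyx|ne] := eqVneq y x; congr Lam; last rewrite IHM //;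
    apply: psub_agree => z _;
    have [<-|nyz] := eqVneq y z; rewrite ?update_same ?update_other //.
  + rewrite subst_notfree //; case: (Hs z) => [|->] //=.
    by rewrite eq_sym -eyx.
  + by rewrite subst_Var_other // eq_sym.
- by rewrite IHM ?IHN.
Qed.

Lemma free_for_closed x (N : term K x.1) t (M : term K t) :
  closed N -> free_for N x M.
Proof.
move=> cN; elim: M => //= [? ? M -> N' ->|y ts M ->|? M -> N' ->] //.
by rewrite cN implybT.
Qed.

(** The syntactic half of the substitution condition on intension functions. *)
Lemma psub_subst s x (N : term K x.1) t (M : term K t) :
  free_for N x M -> psub s (subst N M) = psub (update s (psub s N)) M.
Proof.
elim: M s => //= [y|? ? M IHM N' IHN|y ts M IHM|? M IHM N' IHN] s.
- move=> _; rewrite -/(subst N (Var K y)).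
  have [<-|ne] := eqVneq x y; first by rewrite subst_Var_same update_same.
  by rewrite subst_Var_other //= update_other.
- by case/andP=> HM HN; rewrite IHM // IHN.
- have [->|ne] /= := eqVneq y x.
    by move=> _; rewrite update_update.
  case: (boolP (free x M)) => [fx /andP[fy ff]|nfx _] /=.
    rewrite IHM //; have -> : psub (update s (Var K y)) N = psub s N.
      apply: psub_agree => z fz; rewrite update_other //.
      by apply: contraNneq fy => ->.
    by rewrite update_swap.
  rewrite subst_notfree //; congr Lam; apply: psub_agree => z fz.
  have [<-|nyz] := eqVneq y z; first by rewrite !update_same.
  rewrite !update_other //.
  by apply: contraNneq nfx => ->.
- by case/andP=> HM HN; rewrite IHM // IHN.
Qed.

End Substitution.

(** * Countability of the set of terms *)
Section Countability.
Variables (B : finType) (K : ty B -> Type).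

(** Types need not be recorded: once the codes of the immediate subterms
    determine these as typed terms, the type of the whole follows. *)
Fixpoint term_code (f : const K -> nat) t (M : term K t) : GenTree.tree nat :=
  match M with
  | Con t c => GenTree.Node 0 [:: GenTree.Leaf (f (Tagged K c))]
  | Var x => GenTree.Node 1 [:: GenTree.Leaf (pickle x)]
  | Bot => GenTree.Node 2 [::]
  | App _ _ M N => GenTree.Node 3 [:: term_code f M; term_code f N]
  | Lam x _ M => GenTree.Node 4 [:: GenTree.Leaf (pickle x); term_code f M]
  | Incl _ M N => GenTree.Node 5 [:: term_code f M; term_code f N]
  end.

Lemma term_code_inj (L : set (const K)) (f : const K -> nat) :
  {in L &, injective f} ->
  forall t (M : term K t) t' (M' : term K t'), in_lang L M -> in_lang L M' ->
  term_code f M = term_code f M' -> existT (term K) t M = existT (term K) t' M'.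
Proof.
move=> f_inj t; elim=> [{}t c|x||t1 ts M IHM N IHN|x ts M IHM|ts M IHM N IHN] t'
  [{}t' c'|x'||t1' ts' M' N'|x' ts' M'|ts' M' N'] //=.
- move=> Lc Lc' [] /f_inj; rewrite !inE => H.
  have E : Tagged K c = Tagged K c' by apply: H; [exact: Lc|exact: Lc'].
  exact: (congr1 (fun p : const K => existT (term K) _ (Con (projT2 p))) E).
- by move=> _ _ [] /(pcan_inj pickleK) ->.
- move=> /in_lang_App[LM LN] /in_lang_App[LM' LN'] [] /(IHM _ _ LM LM') eM
    /(IHN _ _ LN LN') eN.
  move: (existT_inj1 eM) => -[e1 e2]; subst t1' ts'.
  by rewrite (existT_inj2 eM) (existT_inj2 eN).
- move=> LM LM' [] /(pcan_inj pickleK) ex /(IHM _ M' LM LM') eM; subst x'.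
  move: (existT_inj1 eM) => -[e1]; subst ts'.
  by rewrite (existT_inj2 eM).
- move=> /in_lang_Incl[LM LN] /in_lang_Incl[LM' LN'] [] /(IHM _ _ LM LM') eM
    /(IHN _ _ LN LN') eN.
  move: (existT_inj1 eM) => -[e1]; subst ts'.
  by rewrite (existT_inj2 eM) (existT_inj2 eN).
Qed.

Lemma countable_terms (L : set (const K)) : countable L ->
  countable [set p : {t : ty B & term K t} | in_lang L (projT2 p)].
Proof.
move=> /countable_injP[f f_inj]; apply/countable_injP.
exists (fun p => pickle (term_code f (projT2 p))) => -[t M] [t' M'].
rewrite !inE /= => LM LM' /(pcan_inj pickleK).
exact: (term_code_inj f_inj).
Qed.

Lemma countable_sentences (L : set (const K)) : countable L ->
  countable [set s : signed K | sentence L (unsign s)].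
Proof.
move=> /countable_terms /countable_injP[g g_inj]; apply/countable_injP.
pose key (s : signed K) := (if s is Lsign _ then true else false,
  g (existT (term K) _ (unsign s))).
exists (fun s => pickle (key s)) => s s'.
rewrite !inE => -[_ Ls] [_ Ls'] /(pcan_inj pickleK)[es eg].
have gE : existT (term K) _ (unsign s) = existT (term K) _ (unsign s').
  by apply: g_inj eg; rewrite inE.
have E := existT_inj2 gE.
by case: s s' es E {Ls Ls' eg gE} => [f|f] [f'|f'] //= _ ->.
Qed.

End Countability.

Lemma countable_enum T (A : set T) : countable A -> A !=set0 ->
  exists e : nat -> T,
    (forall n, A (e n)) /\ (forall x, A x -> exists n, e n = x).
Proof.
move=> /countable_injP[f f_inj] [x0 Ax0].
pose e n := match pselect (exists x, A x /\ f x = n) with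
  | left h => sval (cid h)
  | right _ => x0
  end.
exists e; split=> [n|x Ax]; rewrite /e.
  by case: pselect => [h|//]; case: (svalP (cid h)).
exists (f x); case: pselect => [h|[]]; last by exists x.
by case: (cid h) => y /= [Ay]; apply: f_inj; rewrite inE.
Qed.

(** * Closed terms and Hintikka sets *)
Section Tuples.
Variables (B : finType).

Section Map.
Variables (F G : ty B -> Type) (f : forall t, F t -> G t).

Fixpoint prods_map ts : prods F ts -> prods G ts :=
  match ts with
  | [::] => fun _ => tt
  | t :: ts' => fun ds => (f ds.1, prods_map ds.2)
  end.

End Map.

Fixpoint prods_all (F : ty B -> Type) (Q : forall t, F t -> Prop) ts :
    prods F ts -> Prop :=
  match ts with
  | [::] => fun _ => True
  | t :: ts' => fun ds => Q t ds.1 /\ prods_all Q ds.2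
  end.

End Tuples.

Section ClosedTerms.
Variables (B : finType) (K : ty B -> Type) (L : set (const K)).

Definition closed_term t (M : term K t) := closed M /\ in_lang L M.

Lemma closed_term_App t ts (M : term K (Complex (t :: ts))) N :
  closed_term (App M N) <-> closed_term M /\ closed_term N.
Proof.
split=> [[cMN /in_lang_App[LM LN]]|[[cM LM] [cN LN]]].
  by split; split=> // x; move: (cMN x); rewrite /= negb_or => /andP[].
split; last exact/in_lang_App.
by move=> x; rewrite /= negb_or cM cN.
Qed.

Lemma closed_term_Incl ts (M N : term K (Complex ts)) :
  closed_term (Incl M N) <-> closed_term M /\ closed_term N.
Proof.
split=> [[cMN /in_lang_Incl[LM LN]]|[[cM LM] [cN LN]]].
  by split; split=> // x; move: (cMN x); rewrite /= negb_or => /andP[].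
split; last exact/in_lang_Incl.
by move=> x; rewrite /= negb_or cM cN.
Qed.

Lemma closed_term_apps ts (M : term K (Complex ts)) Cs :
  closed_term (apps M Cs) <-> closed_term M /\ prods_all closed_term Cs.
Proof.
elim: ts M Cs => [|t ts IH] M Cs /=; first by split=> [|[]].
by rewrite IH closed_term_App; split=> [[[] ]|[? []]].
Qed.

Lemma closed_term_subst (x : var B) ts (M : term K (Complex ts)) (N : term K x.1) :
  closed_term (Lam x M) -> closed_term N -> closed_term (subst N M).
Proof.
move=> [cM LM] [cN LN].
have -> : subst N M = psub (update (Var K) N) M.
  by rewrite -{1}[M]psub_Var subst_psub //; right.
split=> [y|]; last first.
  apply: in_lang_psub => // y; have [<-|ne] := eqVneq x y.
    by rewrite update_same.
  by rewrite update_other.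
apply/negP => /free_psub[z fz].
have [<-|ne] := eqVneq x z; first by rewrite update_same (negbTE (cN y)).
by rewrite update_other //= => _; move: (cM z); rewrite /= fz ne.
Qed.

Lemma closed_term_con_terms ts (cs : prods K ts) :
  (forall c, List.In c (con_list cs) -> L c) ->
    prods_all closed_term (con_terms cs).
Proof.
elim: ts cs => [//|t ts IH] cs /= Hcs; split; last first.
  by apply: IH => c Hc; apply: Hcs; right.
by split=> // c /= ->; apply: Hcs; left.
Qed.

(** Only downward closure is demanded: a sentence may carry neither sign. *)
Record hintikka (H : sequent K) : Prop := {
  hintikka_clash : forall f, H (Lsign f) -> H (Rsign f) -> False;
  hintikka_Bot : ~ H (Lsign (Bot K));
  hintikka_LamL : forall (x : var B) ts (M : term K (Complex ts)) N Cs,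
    closed_term (Lam x M) -> closed_term N -> prods_all closed_term Cs ->
    H (Lsign (apps (App (Lam x M) N) Cs)) -> H (Lsign (apps (subst N M) Cs));
  hintikka_LamR : forall (x : var B) ts (M : term K (Complex ts)) N Cs,
    closed_term (Lam x M) -> closed_term N -> prods_all closed_term Cs ->
    H (Rsign (apps (App (Lam x M) N) Cs)) -> H (Rsign (apps (subst N M) Cs));
  hintikka_InclL : forall ts (M N : term K (Complex ts)) Cs,
    closed_term M -> closed_term N -> prods_all closed_term Cs ->
      H (Lsign (Incl M N)) ->
    H (Lsign (apps N Cs)) \/ H (Rsign (apps M Cs));
  hintikka_InclR : forall ts (M N : term K (Complex ts)),
    H (Rsign (Incl M N)) -> exists Cs, [/\ prods_all closed_term Cs,
      H (Lsign (apps M Cs)) & H (Rsign (apps N Cs))]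
}.

End ClosedTerms.

(** * Sequents as sets of signed sentences *)
Section Sequents.
Variables (B : finType) (K : ty B -> Type).
Implicit Types (G : sequent K) (s : signed K) (f : formula K).

Lemma seqt_split G : seqt (@Lsign B K @^-1` G) (@Rsign B K @^-1` G) = G.
Proof.
apply/seteqP; split=> [s [[f Gf <-]|[f Gf <-]] //|[f|f] Gf]; [left|right];
  by exists f.
Qed.

Lemma seqt_addL Pi Sigma f :
  seqt (Pi `|` [set f]) Sigma = seqt Pi Sigma `|` [set Lsign f].
Proof. by rewrite /seqt image_setU image_set1 setUAC. Qed.

Lemma seqt_addR Pi Sigma f :
  seqt Pi (Sigma `|` [set f]) = seqt Pi Sigma `|` [set Rsign f].
Proof. by rewrite /seqt image_setU image_set1 setUA. Qed.

Lemma setU1_id T (A : set T) x : A x -> A `|` [set x] = A.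
Proof. by move=> Ax; apply/setUidPl => _ ->. Qed.

Lemma finite_consts t (M : term K t) : finite_set (consts M).
Proof.
by elim: M => //= *; rewrite ?finite_setU //; exact: finite_set1.
Qed.

Lemma sconstsU1 G s : sconsts (G `|` [set s]) = sconsts G `|` consts (unsign s).
Proof. by rewrite /sconsts bigcup_setU bigcup_set1. Qed.

(** By recursion on the list of types: the remaining constants are chosen
    outside [X] enlarged by the first one, which gives distinctness. *)
Lemma fresh_constants (C : set (const K)) :
  (forall t, infinite_set (consts_of C t)) ->
  forall ts (X : set (const K)), finite_set X ->
  exists cs : prods K ts, List.NoDup (con_list cs) /\
    forall c, List.In c (con_list cs) -> C c /\ ~ X c.
Proof.
move=> Cinf; elim=> [|t ts IH] X finX.
  by exists tt; split=> //; exact: List.NoDup_nil.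
have [c [Cc Xc]] : exists c, consts_of C t c /\ ~ X (Tagged K c).
  apply: contrapT => /forallNP noc; apply: (Cinf t).
  have finX' : finite_set ((fun c : K t => Tagged K c) @^-1` X).
    by apply: finite_preimage finX => c c' _ _; exact: existT_inj2.
  apply: sub_finite_set finX' => c Cc /=.
  by apply: contrapT => Xc; apply: (noc c).
have [cs [cs_uniq csX]] : exists cs : prods K ts, List.NoDup (con_list cs) /\
    forall d, List.In d (con_list cs) -> C d /\ ~ (X `|` [set Tagged K c]) d.
  by apply: IH; rewrite finite_setU; split=> //; exact: finite_set1.
exists (c, cs); split=> /=.
  by apply: List.NoDup_cons => // /csX[_]; apply; right.
by move=> d [<- //|/csX[Cd nXd]]; split=> // Xd; apply: nXd; left.
Qed.

End Sequents.

(** * Saturation of an unprovable sequent *)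
Section Saturation.
Variables (B : finType) (K : ty B -> Type) (L C : set (const K)).
Variable P : set (sequent K).
Hypothesis P_provability : provability_property (L `|` C) P.
Hypothesis C_infinite : forall t, infinite_set (consts_of C t).
Implicit Types (G : sequent K) (s : signed K) (f : formula K).

Let LC := L `|` C.

Lemma sequent_ofU1 G s : sequent_of LC G -> sentence LC (unsign s) ->
  sequent_of LC (G `|` [set s]).
Proof. by move=> LG Ls s' [/LG|->]. Qed.

Lemma provable_rule (Gs : set (sequent K)) G : rule Gs G -> sequent_of LC G ->
  (forall G', Gs G' -> P G') -> P G.
Proof.
case: P_provability => PLC Pcl rG LG GsP; apply: (Pcl Gs) => //; split=> //.
by move=> G' /GsP /PLC.
Qed.

Lemma provable_W G G' : G `<=` G' -> sequent_of LC G' -> P G -> P G'.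
Proof.
move=> GG' LG' PG; rewrite -(seqt_split G'); apply: provable_rule.
- apply: (@rule_W _ _ (@Lsign B K @^-1` G) (@Rsign B K @^-1` G)).
    by move=> f /GG'.
  by move=> f /GG'.
- by rewrite seqt_split.
- by move=> _ ->; rewrite seqt_split.
Qed.

Lemma provable_R G f : sequent_of LC G -> G (Lsign f) -> G (Rsign f) -> P G.
Proof.
move=> LG GL GR; rewrite -(seqt_split G) -(setU1_id (GL : (@Lsign B K @^-1` G) f))
  -(setU1_id (GR : (@Rsign B K @^-1` G) f)).
apply: provable_rule; first exact: rule_R.
  by rewrite seqt_addL seqt_addR seqt_split !setU1_id //; left.
by [].
Qed.

Lemma provable_Bot G : sequent_of LC G -> G (Lsign (Bot K)) -> P G.
Proof.
move=> LG GL; rewrite -(seqt_split G) -(setU1_id (GL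
  : (@Lsign B K @^-1` G) (Bot K))).
apply: provable_rule; first exact: rule_BotL.
  by rewrite seqt_addL seqt_split setU1_id.
by [].
Qed.

(** The conclusion is a set [G] that contains the principal sentence. Sequents
    being sets, that sentence may also stay in the premises, so contraction is
    built in. *)
Lemma provable_LamL G (x : var B) ts (M : term K (Complex ts)) N Cs :
  free_for N x M -> sequent_of LC G -> G (Lsign (apps (App (Lam x M) N) Cs)) ->
  P (G `|` [set Lsign (apps (subst N M) Cs)]) -> P G.
Proof.
move=> ff LG GL PG; rewrite -(seqt_split G) -(setU1_id (GL
  : (@Lsign B K @^-1` G) _)).
apply: provable_rule; first exact: rule_LamL.
  by rewrite seqt_addL seqt_split setU1_id.
by move=> _ ->; rewrite seqt_addL seqt_split.
Qed.

Lemma provable_LamR G (x : var B) ts (M : term K (Complex ts)) N Cs :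
  free_for N x M -> sequent_of LC G -> G (Rsign (apps (App (Lam x M) N) Cs)) ->
  P (G `|` [set Rsign (apps (subst N M) Cs)]) -> P G.
Proof.
move=> ff LG GR PG; rewrite -(seqt_split G) -(setU1_id (GR
  : (@Rsign B K @^-1` G) _)).
apply: provable_rule; first exact: rule_LamR.
  by rewrite seqt_addR seqt_split setU1_id.
by move=> _ ->; rewrite seqt_addR seqt_split.
Qed.

Lemma provable_InclL G ts (M N : term K (Complex ts)) Cs :
  sequent_of LC G -> G (Lsign (Incl M N)) ->
  P (G `|` [set Lsign (apps N Cs)]) -> P (G `|` [set Rsign (apps M Cs)]) -> P G.
Proof.
move=> LG GL PN PM; rewrite -(seqt_split G) -(setU1_id (GL
  : (@Lsign B K @^-1` G) _)).
apply: provable_rule; first exact: rule_InclL.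
  by rewrite seqt_addL seqt_split setU1_id.
by move=> _ [] ->; rewrite ?seqt_addL ?seqt_addR seqt_split.
Qed.

Lemma provable_InclR G ts (M N : term K (Complex ts)) (cs : prods K ts) :
  List.NoDup (con_list cs) ->
  (forall c, List.In c (con_list cs) -> ~ sconsts G c) ->
  sequent_of LC G -> G (Rsign (Incl M N)) ->
  P (G `|` [set Lsign (apps M (con_terms cs))]
       `|` [set Rsign (apps N (con_terms cs))]) -> P G.
Proof.
move=> cs_uniq cs_fresh LG GR PG.
have EG : seqt (@Lsign B K @^-1` G) (@Rsign B K @^-1` G `|` [set Incl M N]) = G.
  by rewrite seqt_addR seqt_split setU1_id.
rewrite -EG; apply: provable_rule.
- by apply: (@rule_InclR _ _ _ _ _ _ _ cs); rewrite ?EG.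
- by rewrite EG.
- by move=> _ ->; rewrite seqt_addL seqt_addR seqt_split setUAC.
Qed.

(** As only finitely many constants of [C] are in use, fresh ones of every type
    remain, also when [G] is infinite. *)
Definition extensible G :=
  [/\ sequent_of LC G, ~ P G & finite_set (C `&` sconsts G)].

Definition witnessed G s := forall ts (M N : term K (Complex ts)),
  s = Rsign (Incl M N) -> exists Cs, [/\ prods_all (closed_term LC) Cs,
    G (Lsign (apps M Cs)) & G (Rsign (apps N Cs))].

Lemma finite_fresh G s : finite_set (C `&` sconsts G) ->
  finite_set (C `&` sconsts (G `|` [set s])).
Proof.
move=> finG; rewrite sconstsU1 setIUr finite_setU; split=> //.
exact/finite_setIr/finite_consts.
Qed.

(** If [s] can be added without becoming provable and is a right inclusion,
    then its two fresh instances can be added as well, for otherwise the right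
    inclusion rule would prove the sequent extended by [s] alone. *)
Lemma extend G s : extensible G -> sentence LC (unsign s) ->
  exists G', [/\ extensible G', G `<=` G', G' s \/ P (G `|` [set s]) &
    G' s -> witnessed G' s].
Proof.
move=> [LG nPG finG] Ls; have [PGs|nPGs] := pselect (P (G `|` [set s])).
  (* An addition that would make the sequent provable is not made. *)
  exists G; split=> //; first by right.
  by move=> Gs; case: nPG; rewrite -(setU1_id Gs).
have LGs := sequent_ofU1 LG Ls.
have finGs := finite_fresh s finG.
have [[ts [M [N es]]]|ns] :=
    pselect (exists ts (M N : term K (Complex ts)), s = Rsign (Incl M N));
      last first.
  exists (G `|` [set s]); split=> //; first by left; right.
  by move=> _ ts M N es; case: ns; exists ts, M, N.
have [cs [cs_uniq cs_fresh]] := fresh_constants C_infinite ts finGs.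
have closed_term_cs : prods_all (closed_term LC) (con_terms cs).
  by apply: closed_term_con_terms => c /cs_fresh[Cc _]; right.
have /closed_term_Incl[cM cN] : sentence LC (Incl M N) by move: Ls; rewrite es.
set G1 := G `|` [set s] `|` [set Lsign (apps M (con_terms cs))].
set G2 := G1 `|` [set Rsign (apps N (con_terms cs))].
exists G2; split.
- split.
  + by apply: sequent_ofU1; [apply: sequent_ofU1|] => //; apply/closed_term_apps.
  + move=> PG2; apply: nPGs; apply: (provable_InclR cs_uniq) PG2 => //.
      by move=> c /cs_fresh[Cc nc] /(conj Cc).
    by right.
  + by do 2!apply: finite_fresh.
- by move=> s' Gs'; do 3!left.
- by left; do 2!left; right.
- move=> _ ts' M' N' es'; move: es'; rewrite es => -[ets eM eN]; subst ts'.
  rewrite -(existT_inj2 eM) -(existT_inj2 eN).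
  by exists (con_terms cs); split=> //; [left; right|right].
Qed.

Section Chain.
Variables (G0 : sequent K) (e : nat -> signed K).
Hypothesis G0_extensible : extensible G0.
Hypothesis e_sentence : forall n, sentence LC (unsign (e n)).

Fixpoint stage n : {G : sequent K | extensible G} :=
  match n with
  | 0 => exist _ G0 G0_extensible
  | n.+1 => let h := cid (extend (svalP (stage n)) (e_sentence n)) in
            exist _ (sval h) (let: And4 p _ _ _ := svalP h in p)
  end.

Definition limit : sequent K := \bigcup_n sval (stage n).

Lemma stageS n : [/\ sval (stage n) `<=` sval (stage n.+1),
  sval (stage n.+1) (e n) \/ P (sval (stage n) `|` [set e n]) &
  sval (stage n.+1) (e n) -> witnessed (sval (stage n.+1)) (e n)].
Proof. by rewrite /=; case: (cid _) => G' /= []. Qed.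

Lemma stage_mono m n : m <= n -> sval (stage m) `<=` sval (stage n).
Proof.
elim: n => [|n IH]; first by rewrite leqn0 => /eqP ->.
rewrite leq_eqVlt ltnS => /predU1P[-> //|/IH sub].
by apply: subset_trans sub _; case: (stageS n).
Qed.

(** A sentence left out of the limit was rejected at some stage, hence makes
    every later stage provable. So if a closure condition failed, the premises
    of the corresponding rule would be provable at one common late stage, and
    this stage would be provable itself. *)
Lemma limit_hintikka : (forall s, sentence LC (unsign s) -> exists n, e n = s) ->
  hintikka LC limit.
Proof.
move=> e_surj.
have stageLC n : sequent_of LC (sval (stage n)) by case: (svalP (stage n)).
have stageP n : ~ P (sval (stage n)) by case: (svalP (stage n)).
have stage_limit n : sval (stage n) `<=` limit by move=> s ?; exists n.
have rejected s : sentence LC (unsign s) -> ~ limit s ->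
    exists n, forall m, n <= m -> P (sval (stage m) `|` [set s]).
  move=> Ls ns; have [n en] := e_surj _ Ls; exists n => m nm.
  case: (stageS n) => _ + _; rewrite en => -[/stage_limit //|].
  apply: provable_W; last exact: sequent_ofU1.
  by apply: setSU; exact: stage_mono.
have closure s s' : sentence LC (unsign s') ->
    (forall G, sequent_of LC G -> G s -> P (G `|` [set s']) -> P G) ->
    limit s -> limit s'.
  move=> Ls' rs [n _ ns]; apply: contrapT => /(rejected _ Ls')[m Hm].
  apply: (stageP (maxn n m)); apply: rs => //.
    exact: (stage_mono (leq_maxl n m)).
  exact/Hm/leq_maxr.
split.
- move=> f [m _ mL] [n _ nR]; apply: (stageP (maxn m n)).
  apply: (@provable_R _ f) => //.
    exact: (stage_mono (leq_maxl m n)).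
  exact: (stage_mono (leq_maxr m n)).
- by move=> [n _ nB]; apply: (stageP n); exact: provable_Bot.
- move=> x ts M N Cs cM cN cCs; apply: closure.
    by apply/closed_term_apps; split=> //; exact: closed_term_subst.
  by move=> G LG GL; apply: provable_LamL => //; apply: free_for_closed; case: cN.
- move=> x ts M N Cs cM cN cCs; apply: closure.
    by apply/closed_term_apps; split=> //; exact: closed_term_subst.
  by move=> G LG GL; apply: provable_LamR => //; apply: free_for_closed; case: cN.
- move=> ts M N Cs cM cN cCs LMN.
  have [RM|nRM] := pselect (limit (Rsign (apps M Cs))); [by right|left].
  have /(rejected _) := nRM; case=> [|n Hn]; first exact/closed_term_apps.
  move: LMN => [k _ kMN]; apply: contrapT => /(rejected _)[|m Hm].
    exact/closed_term_apps.
  (* By this stage the inclusion is present and both premises are provable. *)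
  pose N0 := maxn k (maxn n m); apply: (stageP N0).
  apply: (@provable_InclL _ ts M N Cs) => //.
  + exact: (stage_mono (leq_maxl k _)).
  + by apply: Hm; rewrite /N0 !leq_max leqnn !orbT.
  + by apply: Hn; rewrite /N0 !leq_max leqnn !orbT.
- move=> ts M N RMN.
  have Ls : sentence LC (unsign (Rsign (Incl M N))).
    by case: RMN => k _; exact: stageLC.
  have [n en] := e_surj _ Ls.
  case: (stageS n) => _; rewrite en => -[RMNn|PG] wit; last first.
    case: RMN => k _ kMN; case: (stageP (maxn k n)).
    rewrite -(setU1_id (stage_mono (leq_maxl k n) kMN)).
    apply: provable_W PG; last exact: sequent_ofU1.
    by apply: setSU; exact: (stage_mono (leq_maxr k n)).
  have [Cs [cCs LM RN]] := wit RMNn _ _ _ erefl.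
  by exists Cs; split=> //; exact: (stage_limit n.+1).
Qed.

End Chain.

Lemma saturation (G : sequent K) : countable LC -> extensible G ->
  exists H, [/\ hintikka LC H, sequent_of LC H & G `<=` H].
Proof.
move=> LCc eG.
have [|e [eLC e_surj]] := countable_enum (countable_sentences LCc).
  exists (Lsign (Bot K)); split=> //; exact: sub0set.
exists (limit eG eLC); split; first exact: limit_hintikka.
  by move=> s [n _]; case: (svalP (stage eG eLC n)) => LG _ _; exact: LG.
by move=> s Gs; exists 0.
Qed.

End Saturation.

(** * The model of possible values *)
Section PossibleValues.
Variables (B : finType) (K : ty B -> Type) (L : set (const K)).
Variable H : sequent K.
Hypothesis H_hintikka : hintikka L H.
Variable c0 : forall t, K t.
Hypothesis c0L : forall t, L (Tagged K (c0 t)).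

Definition compatible (F : ty B -> Type) (pterm : forall t, F t -> term K t) ts
    (A : term K (Complex ts)) (X : set (prods F ts)) :=
  [/\ closed_term L A,
    (forall ds, H (Lsign (apps A (prods_map pterm ds))) -> X ds) &
    (forall ds, H (Rsign (apps A (prods_map pterm ds))) -> ~ X ds)].

(** The domains and the projections from domains to terms are defined together,
    because compatibility of a set of tuples refers to the term components of
    those tuples. *)
Fixpoint possible (t : ty B) : {F : Type & F -> term K t} :=
  match t with
  | Basic b => existT (fun F => F -> term K (Basic b))
      {A : term K (Basic b) | closed_term L A} (@proj1_sig _ _)
  | Complex ts => existT (fun F => F -> term K (Complex ts))
      {p : term K (Complex ts) * set (prods (fun u => projT1 (possible u)) ts) |
        compatible (fun u => projT2 (possible u)) p.1 p.2}
      (fun p => (proj1_sig p).1)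
  end.

Definition pval (t : ty B) : Type := projT1 (possible t).
Definition pterm (t : ty B) : pval t -> term K t := projT2 (possible t).

Definition extent (t : ty B) : Type :=
  match t with Basic _ => unit | Complex ts => set (prods pval ts) end.

Definition pext (t : ty B) : pval t -> extent t :=
  match t with
  | Basic _ => fun _ => tt
  | Complex ts => fun d => (proj1_sig d).2
  end.

Definition admissible (t : ty B) : term K t -> extent t -> Prop :=
  match t with
  | Basic _ => fun A _ => closed_term L A
  | Complex ts => fun A X => compatible pterm A X
  end.

(** Among the extensions compatible with a closed term this one is the
    smallest; it shows that every closed term is the first component of some
    element, and it serves as extension of the constants. *)
Definition least_extent (t : ty B) : term K t -> extent t :=
  match t with
  | Basic _ => fun _ => tt
  | Complex ts => fun A => [set ds | H (Lsign (apps A (prods_map pterm ds)))]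
  end.

Lemma least_admissible t (A : term K t) :
  closed_term L A -> admissible A (least_extent A).
Proof.
case: t A => [//|ts] A cA; split=> // ds HR HL.
exact: (hintikka_clash H_hintikka HL HR).
Qed.

Definition pack (t : ty B) : forall (A : term K t) X, admissible A X -> pval t :=
  match t with
  | Basic _ => fun A _ okA => exist _ A okA
  | Complex ts => fun A X okA => exist _ (A, X) okA
  end.

Definition pval0 t : pval t :=
  pack (@least_admissible t (Con (c0 t))
    (conj (fun _ => isT) (fun _ e => eq_ind_r L (c0L t) e))).

(** Intensions must be defined for every term, also outside the language or
    before admissibility is known; [pval0] is then the value. *)
Definition mkpval t (A : term K t) (X : extent t) : pval t :=
  if pselect (admissible A X) is left okA then pack okA else pval0 t.

Lemma pterm_mkpval t (A : term K t) X : admissible A X -> pterm (mkpval A X) = A.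
Proof. by rewrite /mkpval; case: pselect => // okA _; case: t A X okA. Qed.

Lemma pext_mkpval t (A : term K t) X : admissible A X -> pext (mkpval A X) = X.
Proof. by rewrite /mkpval; case: pselect => // okA _;
  case: t A X okA => [b A []|]. Qed.

Lemma pval_admissible t (d : pval t) : admissible (pterm d) (pext d).
Proof. by case: t d => [b [A cA]|ts [[A X] okA]]. Qed.

Lemma mkpvalK t (d : pval t) : mkpval (pterm d) (pext d) = d.
Proof.
rewrite /mkpval; case: pselect => [okA|]; last by have := pval_admissible d.
case: t d okA => [b [A cA]|ts [[A X] okA]] okA' /=; congr exist;
  exact: Prop_irrelevance.
Qed.

Lemma closed_term_admissible t (A : term K t) X : admissible A X -> closed_term L A.
Proof. by case: t A X => [//|ts] A X []. Qed.

Lemma closed_term_pterm t (d : pval t) : closed_term L (pterm d).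
Proof. exact: closed_term_admissible (pval_admissible d). Qed.

Lemma closed_term_prods_map_pterm ts (ds : prods pval ts)
  : prods_all (closed_term L) (prods_map pterm ds).
Proof. by elim: ts ds => [//|t ts IH] ds /=; split=> //;
  exact: closed_term_pterm. Qed.

(** The witnesses provided by a Hintikka set are terms, whereas extensions
    consist of tuples of elements; this lemma passes from the former to the
    latter. *)
Lemma pterm_surj ts (Cs : prods (term K) ts) : prods_all (closed_term L) Cs ->
  exists ds, prods_map pterm ds = Cs.
Proof.
elim: ts Cs => [[]|t ts IH [A Cs]] /=; first by exists tt.
move=> [cA /IH[ds <-]].
exists (mkpval A (least_extent A), ds).
by rewrite /= pterm_mkpval //; exact: least_admissible.
Qed.

Definition closing (a : assignment pval) : assignment (term K) :=
  fun x => pterm (a x).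

(** The truth clauses. In the clause for an application the argument enters as
    a pair, with its term and its own extension. *)
Fixpoint pvalue t (M : term K t) : assignment pval -> extent t :=
  match M in term _ t return assignment pval -> extent t with
  | Con _ c => fun a => least_extent (Con c)
  | Var x => fun a => pext (a x)
  | Bot => fun a => set0
  | App _ _ M N => fun a =>
      [set ds | pvalue M a (mkpval (psub (closing a) N) (pvalue N a), ds)]
  | Lam x _ M => fun a => [set ds | pvalue M (update a ds.1) ds.2]
  | Incl _ M N => fun a => [set _ | pvalue M a `<=` pvalue N a]
  end.

Definition pintn (a : assignment pval) t (M : term K t) : pval t :=
  mkpval (psub (closing a) M) (pvalue M a).

Lemma closing_update a (x : var B) (d : pval x.1) :
  closing (update a d) = update (closing a) (pterm d).
Proof. exact: (map_update pterm). Qed.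

Lemma closed_term_psub a t (M : term K t) : in_lang L M ->
  closed_term L (psub (closing a) M).
Proof.
move=> LM; split=> [x|]; last by apply: in_lang_psub => // x;
  case: (closed_term_pterm (a x)).
by apply/negP => /free_psub[y _]; case: (closed_term_pterm (a y)) => /(_ x) /negP.
Qed.

(** The reduct of a closed instance of [(Lam x M) d] is again a closed instance
    of [M], for the updated assignment; this links the lambda conditions of a
    Hintikka set to the truth clause of [Lam]. *)
Lemma subst_pterm a (x : var B) (d : pval x.1) t (M : term K t) :
  subst (pterm d) (psub (update (closing a) (Var K x)) M) =
  psub (closing (update a d)) M.
Proof.
rewrite subst_psub => [|z]; last first.
  have [<-|ne] := eqVneq x z; first by right; rewrite update_same.
  by left; rewrite update_other //; case: (closed_term_pterm (a z)).
apply: psub_agree => z _; rewrite closing_update.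
have [<-|ne] := eqVneq x z; first by rewrite !update_same subst_Var_same.
rewrite !update_other // subst_notfree //.
by case: (closed_term_pterm (a z)).
Qed.

(** The heart of the construction. Each condition on a Hintikka set is what one
    step of this induction on terms needs: [hintikka_clash] for constants,
    [hintikka_Bot] for falsity, the lambda conditions for abstraction through
    [subst_pterm], and the inclusion conditions for [Incl]. For a left
    inclusion, a tuple of the smaller extension that [H] does not put into the
    larger one would be excluded from the smaller one. *)
Lemma pvalue_admissible a t (M : term K t) : in_lang L M ->
  admissible (psub (closing a) M) (pvalue M a).
Proof.
elim: M a => [{}t c|x||u ts M IHM N IHN|x ts M IHM|ts M IHM N IHN] a.
- by move=> Lc; apply: least_admissible; split.
- by move=> _; exact: pval_admissible.
- move=> _; split=> [||_ _ []] //=; first by split=> //; exact: sub0set.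
  by move=> _ /(hintikka_Bot H_hintikka).
- move=> LMN; move: (LMN) => /in_lang_App[LM LN].
  have [_ ML MR] := IHM a LM.
  have tmN := pterm_mkpval (IHN a LN).
  split; first exact: (closed_term_psub a LMN).
    by move=> ds /= HL; apply: ML => /=; rewrite tmN.
  by move=> ds /= HR; apply: MR => /=; rewrite tmN.
- move=> LM; have cM := @closed_term_psub a _ (Lam x M) LM.
  split=> // -[d ds] /= Hds; have [_ ML MR] := IHM (update a d) LM.
    apply: ML; rewrite -subst_pterm; apply: (hintikka_LamL H_hintikka) => //.
      exact: closed_term_pterm.
    exact: closed_term_prods_map_pterm.
  apply: MR; rewrite -subst_pterm; apply: (hintikka_LamR H_hintikka) => //.
    exact: closed_term_pterm.
  exact: closed_term_prods_map_pterm.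
- move=> LMN; move: (LMN) => /in_lang_Incl[LM LN].
  have [cM ML MR] := IHM a LM; have [cN NL NR] := IHN a LN.
  split; first exact: (closed_term_psub a LMN).
    move=> [] /= HL ds Mds.
    have [|HR] := hintikka_InclL H_hintikka cM cN (closed_term_prods_map_pterm
      ds) HL.
      exact: NL.
    by case: (MR ds).
  move=> [] /= /(hintikka_InclR H_hintikka)[Cs [/pterm_surj[ds <-] HL HR]] sub.
  exact: NR HR (sub _ (ML _ HL)).
Qed.

Lemma pvalue_agree a a' t (M : term K t) :
  (forall x, free x M -> a x = a' x) -> pvalue M a = pvalue M a'.
Proof.
elim: M a a' => //= [x|? ? M IHM N IHN|x ts M IHM|? M IHM N IHN] a a' Ha.
- by rewrite Ha.
- rewrite (IHM a a') ?(IHN a a') => [|x Hx|x Hx]; try by apply: Ha;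
    rewrite Hx ?orbT.
  rewrite (@psub_agree _ _ (closing a) (closing a')) // => x Hx.
  by rewrite /closing Ha // Hx orbT.
- apply/funext => ds; rewrite /mkset; congr (_ ds.2); apply: IHM => y Hy.
  have [<-|ne] := eqVneq x y; first by rewrite !update_same.
  by rewrite !update_other // Ha // ne.
- by rewrite (IHM a a') ?(IHN a a') // => x Hx; apply: Ha; rewrite Hx ?orbT.
Qed.

Lemma pintn_agree a a' t (M : term K t) :
  (forall x, free x M -> a x = a' x) -> pintn a M = pintn a' M.
Proof.
move=> Ha; rewrite /pintn (pvalue_agree Ha); congr mkpval.
by apply: psub_agree => x /Ha; rewrite /closing => ->.
Qed.

Lemma psub_closing_subst a (x : var B) (N : term K x.1) t (M : term K t) :
  in_lang L N -> free_for N x M ->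
  psub (closing a) (subst N M) = psub (closing (update a (pintn a N))) M.
Proof.
move=> LN ff; rewrite psub_subst // closing_update pterm_mkpval //.
exact: pvalue_admissible.
Qed.

Lemma pvalue_subst a (x : var B) (N : term K x.1) t (M : term K t) :
  in_lang L N -> free_for N x M ->
  pvalue (subst N M) a = pvalue M (update a (pintn a N)).
Proof.
move=> LN; elim: M a => //= [y|? ? M IHM N' IHN|y ts M IHM|? M IHM N' IHN] a.
- move=> _; rewrite -/(subst N (Var K y)).
  have [<-|ne] := eqVneq x y.
    rewrite subst_Var_same update_same pext_mkpval //.
    exact: pvalue_admissible.
  by rewrite subst_Var_other //= update_other.
- by case/andP=> fM fN; rewrite IHM // IHN // psub_closing_subst.
- have [->|ne] /= := eqVneq y x.
    by move=> _; apply/funext => ds; rewrite /mkset update_update.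
  case: (boolP (free x M)) => [fx /andP[fy ff]|nfx _] /=; apply/funext => ds;
    rewrite /mkset.
    have EN : pintn (update a ds.1) N = pintn a N.
      apply: pintn_agree => z fz; rewrite update_other //.
      by apply: contraNneq fy => ->.
    by rewrite IHM // EN update_swap.
  rewrite subst_notfree //; congr (_ ds.2); apply: (@pvalue_agree _ _ _ M) => z fz.
  have [<-|nyz] := eqVneq y z; first by rewrite !update_same.
  rewrite !update_other //.
  by apply: contraNneq nfx => ->.
- by case/andP=> fM fN; rewrite IHM // IHN.
Qed.

Definition possible_structure : structure K :=
  @Build_structure B K pval (fun t => inhabits (pval0 t)) pintn (fun ts d =>
    pext d).

Lemma possible_value a ts (M : term K (Complex ts)) : in_lang L M ->
  @value B K possible_structure a ts M = pvalue M a.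
Proof. by move=> LM; exact: pext_mkpval (pvalue_admissible a LM). Qed.

Lemma possible_model : intensional_model L possible_structure.
Proof.
split.
- split.
  + by move=> a x; exact: mkpvalK.
  + by move=> a a' t M _; exact: pintn_agree.
  + move=> a t M x N _ LN ff.
    by rewrite /= /pintn pvalue_subst // psub_closing_subst.
- by move=> a; rewrite possible_value //; exact: sub0set.
- by move=> a t ts A A' LA LA'; rewrite !possible_value //; exact/in_lang_App.
- by move=> a x ts A LA; rewrite possible_value //; apply/funext => ds;
    rewrite /mkset possible_value.
- move=> a ts A A' LA LA'; rewrite !possible_value //; last exact/in_lang_Incl.
  split=> [E|sub]; first by have : [set tt] tt by []; rewrite -E.
  by apply/seteqP; split=> [[]|[] _].
Qed.

Lemma possible_refutes : sequent_of L H -> refutes possible_structure H.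
Proof.
move=> LH; have agree a f : sentence L f ->
    (H (Lsign f) -> @value B K possible_structure a _ f tt) /\
    (H (Rsign f) -> ~ @value B K possible_structure a _ f tt).
  move=> [cf Lf]; rewrite possible_value //.
  by have [_ HL HR] := pvalue_admissible a Lf; move: (HL tt) (HR tt);
    rewrite psub_closed.
split=> f Hf; have Lf := LH _ Hf.
  exists (fun x => pval0 x.1).
  by apply/seteqP; split=> [[]|[] _] //; apply: (agree _ _ Lf).1.
by move=> [a E]; apply: ((agree a f Lf).2 Hf); rewrite E.
Qed.

End PossibleValues.

Fixpoint prods_all2 (B : finType) (F G : ty B -> Type) (R : forall t, F t ->
  G t -> Prop) ts :
    prods F ts -> prods G ts -> Prop :=
  match ts with
  | [::] => fun _ _ => True
  | t :: ts' => fun ds es => R t ds.1 es.1 /\ prods_all2 R ds.2 es.2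
  end.

Lemma fresh_var (B : finType) (t : ty B) (s : seq (var B))
  : exists n, (t, n) \notin s.
Proof.
exists (\max_(x <- s) x.2).+1; apply/negP => ts.
by have := @leq_bigmax_seq _ s (fun _ => true) snd _ ts isT; rewrite /= ltnn.
Qed.

(** * Leibniz equality in an intensional model *)
Section Leibniz.
Variables (B : finType) (K : ty B -> Type) (L : set (const K)).
Variable M : structure K.
Hypothesis M_model : intensional_model L M.

Let M_intn := model_intn M_model.

Lemma ex_point t : exists d : M t, True.
Proof. by have [d] := dom_nonempty M t; exists d. Qed.

Definition point t : M t := sval (cid (ex_point t)).

Lemma in_lang_Var x : in_lang L (Var K x).
Proof. exact: sub0set. Qed.

Lemma in_lang_Bot : in_lang L (Bot K).
Proof. exact: sub0set. Qed.

Lemma value_Var (a : assignment M) n ts :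
  value a (Var K (Complex ts, n)) = ext (a (Complex ts, n)).
Proof. exact: (congr1 (@ext _ _ M ts) (int_var M_intn a (Complex ts, n))). Qed.

Lemma value_Incl_tt (a : assignment M) ts (A A' : term K (Complex ts)) :
  in_lang L A -> in_lang L A' ->
  value a (Incl A A') tt <-> value a A `<=` value a A'.
Proof.
move=> LA LA'; rewrite -(value_Incl M_model) //.
by split=> [Vtt|->//]; apply/seteqP; split=> -[].
Qed.

Definition leibniz t (d d' : M t) :=
  forall p : M (Complex [:: t]), ext p (d, tt) <-> ext p (d', tt).

Lemma leibniz_sym t (d d' : M t) : leibniz d d' -> leibniz d' d.
Proof. by move=> dd' p; rewrite dd'. Qed.

Lemma leibniz_trans t (d d' d'' : M t) :
  leibniz d d' -> leibniz d' d'' -> leibniz d d''.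
Proof. by move=> dd' dd'' p; rewrite dd'. Qed.

(** The property of [d] that the value of [A] at [d] belongs to [p] is the
    denotation of [Lam x (App y A)], where the fresh variable [y] denotes
    [p]. *)
Lemma leibniz_update (a : assignment M) (x : var B) (d d' : M x.1) t (A
  : term K t) :
  in_lang L A -> leibniz d d' ->
  leibniz (intn (update a d) A) (intn (update a d') A).
Proof.
move=> LA dd' p.
have [n] := fresh_var (Complex [:: t]) (x :: fv A).
set y : var B := (_, n); rewrite inE negb_or => /andP[yx yA].
have LyA : in_lang L (App (Var K y) A) by apply/in_lang_App; split=> //;
  exact: in_lang_Var.
have E (e : M x.1) :
    ext (intn (update a (p : M y.1)) (Lam x (App (Var K y) A))) (e, tt) <->
    ext p (intn (update a e) A, tt).
  rewrite -/(value _ _) (value_Lam M_model) //=.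
  rewrite (value_App M_model) //=.
  rewrite value_Var update_other 1?eq_sym // update_same.
  rewrite (int_free M_intn (a' := update a e)) // => z fz.
  have [<-|nxz] := eqVneq x z; first by rewrite !update_same.
  rewrite !update_other //.
  by apply: contraNneq yA => ->; rewrite -mem_fv.
by rewrite -!E; exact: dd'.
Qed.

(** Only finitely many variables are free in [A], so [a] can be changed into
    [a'] one variable at a time. *)
Lemma leibniz_intn (a a' : assignment M) t (A : term K t) :
  in_lang L A -> (forall x, leibniz (a x) (a' x)) ->
  leibniz (intn a A) (intn a' A).
Proof.
move=> LA aa'.
pose mix (s : seq (var B)) : assignment M := fun x => if x \in s then a' x else a x.
have step s : leibniz (intn a A) (intn (mix s) A).
  elim: s => [|x s IH]; first by have -> : mix [::] = a by [].
  have -> : mix (x :: s) = update (mix s) (a' x).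
    apply: functional_extensionality_dep => y; rewrite /mix inE eq_sym.
    have [<-|ne] := eqVneq x y; first by rewrite update_same.
    by rewrite update_other.
  apply: leibniz_trans IH _; rewrite -{1}[mix s](update_id _ x).
  by apply: leibniz_update => //; rewrite /mix; case: ifP.
have -> : intn a' A = intn (mix (fv A)) A; last exact: step.
by apply: (int_free M_intn) => // x; rewrite mem_fv /mix => ->.
Qed.

(** The separating property is denoted by [Lam v v]. *)
Lemma leibniz_truth (d d' : M (Complex [::])) : leibniz d d' ->
  ext d tt <-> ext d' tt.
Proof.
move=> dd'; pose v : var B := (Complex [::], 0).
pose a : assignment M := fun x => point x.1.
have E (e : M v.1) : ext (intn a (Lam v (Var K v))) (e, tt) <-> ext e tt.
  rewrite -/(value _ _) (value_Lam M_model) //=.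
  by rewrite value_Var update_same.
by rewrite -!E; exact: dd'.
Qed.

(** Applying [d] to the first component of the tuple lowers the arity: the
    value of [App z w], with [z] and [w] denoting [d] and that component,
    depends on both only up to Leibniz equality. *)
Lemma leibniz_ext ts (d d' : M (Complex ts)) ds ds' :
  leibniz d d' -> prods_all2 leibniz ds ds' -> ext d ds <-> ext d' ds'.
Proof.
elim: ts d d' ds ds' => [|t ts IH] d d'; first by move=> [] [] dd' _;
  exact: leibniz_truth.
move=> [e ds] [e' ds'] dd' [/= ee' dsds'].
pose z : var B := (Complex (t :: ts), 0); pose w : var B := (t, 1).
(* The indices 0 and 1 keep z and w distinct whatever their types are. *)
pose asg (f : M z.1) (g : M w.1) : assignment M :=
  update (update (fun x => point x.1) f) g.
pose A : term K (Complex ts) := App (Var K z) (Var K w).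
have LA : in_lang L A by apply/in_lang_App; split; exact: in_lang_Var.
have E f g us : ext (intn (asg f g) A) us <-> ext f (g, us).
  rewrite -/(value _ _) (value_App M_model) //=.
  rewrite value_Var (int_var M_intn _ w) /asg update_same update_other
    ?update_same //.
  by rewrite xpair_eqE andbF.
rewrite -!E; apply: IH => //; apply: leibniz_intn => // x; rewrite /asg.
have [<-|nw] := eqVneq w x; first by rewrite !update_same.
rewrite !(update_other _ _ nw).
by have [<-|nz] := eqVneq z x; rewrite ?update_same // !update_other.
Qed.

Lemma Complex1_neq (t : ty B) : t <> Complex [:: t].
Proof.
move/(congr1 (@ty_encode B)) => /=.
(* The two types are told apart by the nesting depth of their codes. *)
pose fix depth (T : GenTree.tree B) : nat :=
  if T is GenTree.Node _ l then (sumn (map depth l)).+1 else 0.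
by move/(congr1 depth) => /= /eqP; rewrite addn0 (ltn_eqF (leqnn _)).
Qed.

(** Properties have complements, denoted by [Lam z (Imp (App y z) Bot)], so one
    direction of the equivalence suffices. *)
Lemma leibniz_half t (d d' : M t) :
  (forall p : M (Complex [:: t]), ext p (d, tt) -> ext p (d', tt)) -> leibniz d d'.
Proof.
move=> sub p; split; first exact: sub.
pose y : var B := (Complex [:: t], 0); pose z : var B := (t, 1).
pose A : formula K := App (Var K y) (Var K z).
have LA : in_lang L A by apply/in_lang_App; split; exact: in_lang_Var.
pose a : assignment M := update (fun x => point x.1) (p : M y.1).
have E (e : M z.1) : value a (Lam z (Imp A (Bot K))) (e, tt) <-> ~ ext p (e, tt).
  rewrite (value_Lam M_model) /=; last first.
    by apply/in_lang_Incl; split=> //; exact: in_lang_Bot.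
  rewrite value_Incl_tt // ?(value_Bot M_model).
  rewrite (value_App M_model) //=.
  rewrite value_Var (int_var M_intn _ z) update_same update_other; last first.
    by rewrite xpair_eqE andbF.
  rewrite /a update_same; split=> [nsub pe|npe []]; last by move/npe.
  exact: (nsub tt).
move=> pd'; apply: contrapT => npd.
by have /E := sub (intn a (Lam z (Imp A (Bot K)))) ((E d).2 npd).
Qed.

Lemma in_lang_Eqt m t (N N' : term K t) :
  in_lang L N -> in_lang L N' -> in_lang L (Eqt m N N').
Proof. by move=> LN LN'; rewrite /in_lang /= !(subUset, set0U); do !split. Qed.

Lemma value_Eqt (a : assignment M) t n n' m (d d' : M t) : n <> n' ->
  let x : var B := (t, n) in let x' : var B := (t, n') in
  value a (Lam x (Lam x' (Eqt m (Var K x) (Var K x')))) (d, (d', tt)) ->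
  leibniz d d'.
Proof.
move=> nn' x x'.
pose y : var B := (Complex [:: t], m).
have Lapp (z : var B) (N : term K t) : in_lang L N -> in_lang L (App (Var K y) N).
  by move=> LN; apply/in_lang_App; split=> //; exact: in_lang_Var.
have LImp : in_lang L (Imp (App (Var K y) (Var K x)) (App (Var K y) (Var K x'))).
  by apply/in_lang_Incl; split; apply: (Lapp y); exact: in_lang_Var.
have LTop : in_lang L (Top K) by apply/in_lang_Incl; split; exact: in_lang_Bot.
have LEq : in_lang L (Eqt m (Var K x) (Var K x')) by apply/in_lang_Incl; split.
rewrite (value_Lam M_model) // => V.
have {}V : value (update a (d
  : M x.1)) (Lam x' (Eqt m (Var K x) (Var K x'))) (d', tt) := V.
rewrite (value_Lam M_model) // in V.
have {V} : value (update (update a (d : M x.1)) (d' : M x'.1))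
  (Eqt m (Var K x) (Var K x')) tt := V.
rewrite value_Incl_tt // !(value_Lam M_model) // => sub.
have yx (z : var B) : z.1 = t -> y != z.
  by move=> zt; apply/eqP => yz; move: zt; rewrite -yz => /esym /Complex1_neq.
have x'x : x' != x by rewrite xpair_eqE eqxx /= eq_sym; apply/eqP.
(* Instances of the quantified variable y are the properties of the model. *)
apply: leibniz_half => p pd; have /= := sub (p, tt).
rewrite !value_Incl_tt //; try by apply: (Lapp y); exact: in_lang_Var.
move=> /(_ (fun _ h => h)) /(_ tt).
rewrite !(value_App M_model) //=.
rewrite value_Var (int_var M_intn _ x) (int_var M_intn _ x') update_same.
rewrite !(update_other _ _ (yx _ _)) // update_same (update_other _ _ x'x)
  update_same.
exact.
Qed.

End Leibniz.

(** * The countable normal quotient *)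
Section LowenheimSkolem.
Variables (B : finType) (K : ty B -> Type) (L : set (const K)).
Variable M : structure K.
Hypothesis M_model : intensional_model L M.
Variable e : nat -> {t : ty B & term K t}.
Hypothesis e_surj : forall t (A : term K t), in_lang L A ->
  exists n, e n = existT (term K) t A.

Let M_intn := model_intn M_model.

Definition default : forall t, M t := fun t => point M t.

Fixpoint component ts : prods M ts -> nat -> forall t, M t :=
  match ts with
  | [::] => fun _ _ => default
  | t :: ts' => fun ds i =>
      if i is j.+1 then component ds.2 j else dfwith default ds.1
  end.

Fixpoint defaults ts : prods M ts :=
  match ts with
  | [::] => tt
  | t :: ts' => (default t, defaults ts')
  end.

Definition counterexample (a : assignment M) ts (A A' : term K (Complex ts))
  : prods M ts :=
  if pselect (exists ds, value a A ds /\ ~ value a A' ds) is left h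
  then sval (cid h) else defaults ts.

(** For [i = 0] the value of the [n]-th term; for [i = j.+1], provided that the
    [n]-th term is an inclusion, the [j]-th component of a counterexample to
    it. *)
Definition skolem (n i : nat) (a : assignment M) : forall t, M t :=
  let A := projT2 (e n) in
  if i is j.+1 then
    match A with
    | Incl _ A1 A2 => component (counterexample a A1 A2) j
    | _ => default
    end
  else dfwith default (intn a A).

(** The value of a variable is stored at the position given by its code. A list
    thus describes an assignment on finitely many variables, which is all that
    a term depends on. *)
Definition env (l : seq (forall t, M t)) : assignment M :=
  fun x => nth default l (pickle x) x.1.

(** Trees are names for the generated elements: a node applies the Skolem
    function coded by its label to the assignment described by its children.
    There are countably many trees, hence countably many generated elements. *)
Fixpoint gen (T : GenTree.tree unit) : forall t, M t :=
  match T with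
  | GenTree.Leaf _ => default
  | GenTree.Node k l =>
      let ni := odflt (0, 0) (unpickle k) in
      skolem ni.1 ni.2 (env (map gen l))
  end.

Definition hull t (d : M t) := exists T, gen T t = d.

Lemma hull_default t : hull (default t).
Proof. by exists (GenTree.Leaf tt). Qed.

Lemma hull_env (a : assignment M) (s : seq (var B)) : (forall x, hull (a x)) ->
  exists l, forall x, x \in s -> env (map gen l) x = a x.
Proof.
move=> /choice[c Hc].
pose l := mkseq (fun i => if unpickle i is Some x then c x else GenTree.Leaf tt)
  (\max_(x <- s) pickle x).+1.
exists l => x xs.
have lt_x : pickle x < (\max_(x <- s) pickle x).+1.
  by rewrite ltnS (@leq_bigmax_seq _ s (fun _ => true) pickle).
by rewrite /env (nth_map (GenTree.Leaf tt)) ?size_mkseq // nth_mkseq // pickleK Hc.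
Qed.

Lemma hull_skolem l n i t : hull (skolem n i (env (map gen l)) t).
Proof. by exists (GenTree.Node (pickle (n, i)) l); rewrite /= pickleK. Qed.

Lemma hull_intn (a : assignment M) t (A : term K t) :
  (forall x, hull (a x)) -> in_lang L A -> hull (intn a A).
Proof.
move=> /(hull_env (fv A))[l Hl] LA; have [n en] := e_surj LA.
have -> : intn a A = skolem n 0 (env (map gen l)) t; last exact: hull_skolem.
rewrite /skolem en dfwith_in; apply: (int_free M_intn) => // x.
by rewrite mem_fv => /Hl.
Qed.

Lemma hull_components ts (ds : prods M ts) :
  (forall i t, hull (component ds i t)) -> prods_all hull ds.
Proof.
elim: ts ds => [//|t ts IH] ds Hds; split.
  by have := Hds 0 t; rewrite /= dfwith_in.
by apply: IH => i; exact: (Hds i.+1).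
Qed.

(** The Tarski-Vaught criterion. The components of a counterexample are in the
    hull; the assignment is first replaced by one that a list describes, so
    that [skolem] finds the same inclusion false. *)
Lemma hull_Incl (a : assignment M) ts (A A' : term K (Complex ts)) :
  (forall x, hull (a x)) -> in_lang L A -> in_lang L A' ->
  (forall ds, prods_all hull ds -> value a A ds -> value a A' ds) ->
  value a A `<=` value a A'.
Proof.
move=> Ha LA LA' sub ds Ads; apply: contrapT => nA'ds.
have [l Hl] := hull_env (fv A ++ fv A') Ha.
pose b := env (map gen l).
have EA : value a A = value b A.
  congr ext; apply: (int_free M_intn) => // x.
  by rewrite mem_fv /b => xA; rewrite Hl // mem_cat xA.
have EA' : value a A' = value b A'.
  congr ext; apply: (int_free M_intn) => // x.
  by rewrite mem_fv /b => xA; rewrite Hl // mem_cat xA orbT.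
pose w := counterexample b A A'.
have [Aw nA'w] : value b A w /\ ~ value b A' w.
  rewrite /w /counterexample; case: pselect => [h|[]];
    first by case: (svalP (cid h)).
  by exists ds; rewrite -EA -EA'.
rewrite -{}EA -{}EA' in Aw nA'w.
apply: nA'w (sub _ _ Aw); apply: hull_components => i t.
have [n en] := e_surj ((in_lang_Incl L A A').2 (conj LA LA')).
by have := hull_skolem l n i.+1 t; rewrite /skolem en.
Qed.

(** Classes are taken in the whole of [M], not in the hull, and with respect to
    the Leibniz equality of [M]; those that meet the hull are kept. *)
Definition qdom t := {X : set (M t) | exists2 d, hull d & X = leibniz d}.

(** The second branch is only there to make the function total. *)
Definition class t (d : M t) : qdom t :=
  if pselect (hull d) is left h
  then exist _ (leibniz d : set (M t)) (ex_intro2 _ _ d h erefl)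
  else exist _ (leibniz (default t)
    : set (M t)) (ex_intro2 _ _ (default t) (hull_default t) erefl).

Definition rep t (X : qdom t) : M t := s2val (cid2 (svalP X)).

Lemma hull_rep t (X : qdom t) : hull (rep X).
Proof. exact: (s2valP (cid2 (svalP X))). Qed.

Lemma sval_rep t (X : qdom t) : sval X = leibniz (rep X).
Proof. exact: (s2valP' (cid2 (svalP X))). Qed.

Lemma qdom_eq t (X Y : qdom t) : leibniz (rep X) (rep Y) -> X = Y.
Proof.
move=> XY; have : sval X = sval Y.
  rewrite !sval_rep; apply/seteqP; split=> d; first exact/leibniz_trans/leibniz_sym.
  exact: leibniz_trans.
case: X Y {XY} => [X hX] [Y hY] /= XY; subst Y; congr exist;
  exact: Prop_irrelevance.
Qed.

Lemma rep_class t (d : M t) : hull d -> leibniz (rep (class d)) d.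
Proof.
move=> hd; rewrite -/((leibniz (rep (class d)) : set (M t)) d) -sval_rep /class.
by case: pselect.
Qed.

Lemma class_rep t (X : qdom t) : class (rep X) = X.
Proof. exact: qdom_eq (rep_class (hull_rep X)). Qed.

Lemma class_eq t (d d' : M t) : hull d -> hull d' -> leibniz d d' ->
  class d = class d'.
Proof.
move=> hd hd' dd'; apply: qdom_eq; apply: leibniz_trans (rep_class hd) _.
exact/(leibniz_trans dd')/leibniz_sym/rep_class.
Qed.

Definition lift (a : assignment qdom) : assignment M := fun x => rep (a x).

Lemma hull_lift a x : hull (lift a x).
Proof. exact: hull_rep. Qed.

Lemma lift_update a (x : var B) (X : qdom x.1) :
  lift (update a X) = update (lift a) (rep X).
Proof. exact: (map_update rep). Qed.

Definition quotient : structure K :=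
  @Build_structure B K qdom (fun t => inhabits (class (default t)))
    (fun a t A => class (intn (lift a) A))
    (fun ts X => [set ds | ext (rep X) (prods_map rep ds)]).

Lemma leibniz_prods_map_class ts (ds : prods M ts) : prods_all hull ds ->
  prods_all2 (@leibniz B K M) (prods_map rep (prods_map class ds)) ds.
Proof.
by elim: ts ds => [//|t ts IH] ds [hd hds]; split; [exact: rep_class|exact: IH].
Qed.

Lemma prods_all2_leibniz_refl ts (ds : prods M ts)
  : prods_all2 (@leibniz B K M) ds ds.
Proof. by elim: ts ds => [//|t ts IH] ds; split. Qed.

(** Truth in the quotient is truth in [M] under any choice of representatives;
    the representative of the class of an intension is only Leibniz equal to
    that intension, which [leibniz_ext] makes harmless. *)
Lemma quotient_value (a : assignment qdom) ts (A : term K (Complex ts)) :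
  in_lang L A ->
  @value B K quotient a ts A = [set ds | value (lift a) A (prods_map rep ds)].
Proof.
move=> LA; apply/funext => ds; apply/propext.
apply: (leibniz_ext M_model); last exact: prods_all2_leibniz_refl.
by apply/rep_class/hull_intn => // x; exact: hull_lift.
Qed.

Lemma leibniz_update_rep (a : assignment M) (x : var B) (d : M x.1) :
  hull d -> forall y, leibniz (update a (rep (class d)) y) (update a d y).
Proof.
move=> hd y; have [<-|ne] := eqVneq x y; last by rewrite !update_other.
by rewrite !update_same; exact: rep_class.
Qed.

Lemma quotient_model : intensional_model L quotient.
Proof.
have hlift a t (A : term K t) : in_lang L A -> hull (intn (lift a) A).
  by move=> LA; apply: hull_intn => // x; exact: hull_lift.
split.
- split=> /=.
  + by move=> a x; rewrite (int_var M_intn) class_rep.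
  + move=> a a' t A LA aa'; congr class; apply: (int_free M_intn) => // x fx.
    by rewrite /lift aa'.
  + move=> a t A x N LA LN ff; rewrite (int_subst M_intn) //.
    have hN := hlift a _ _ LN.
    apply: class_eq.
    * apply: hull_intn => // y; have [<-|ne] := eqVneq x y.
        by rewrite update_same.
      by rewrite update_other //; exact: hull_lift.
    * exact: hlift.
    * rewrite lift_update; apply: (leibniz_intn M_model) => // y.
      exact/leibniz_sym/leibniz_update_rep.
- by move=> a; rewrite quotient_value // (value_Bot M_model).
- move=> a t ts A A' LA LA'; have LAA' : in_lang L (App A A') by exact/in_lang_App.
  rewrite !quotient_value // (value_App M_model) //.
  apply/funext => ds; apply/propext; apply: (leibniz_ext M_model) => //.
  split; last exact: prods_all2_leibniz_refl.
  exact/leibniz_sym/rep_class/hlift.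
- move=> a x ts A LA; rewrite quotient_value // (value_Lam M_model) //.
  by apply/funext => ds; rewrite /mkset quotient_value // lift_update.
- move=> a ts A A' LA LA'; have LAA' : in_lang L (Incl A A') by exact/in_lang_Incl.
  rewrite !quotient_value //.
  have -> : ([set ds | value (lift a) (Incl A A') (@prods_map _ _ _ rep [::]
    ds)] = [set tt]) <->
      value (lift a) (Incl A A') tt.
    by split=> [E|Vtt]; [have : [set tt] tt by []; rewrite -E|apply/seteqP;
      split=> -[]].
  rewrite (value_Incl_tt M_model) //; split=> [sub ds|sub]; first exact: sub.
  apply: hull_Incl => // [x|ds hds Vds]; first exact: hull_lift.
  have ext_class A0 : value (lift a) A0 (prods_map rep (prods_map class ds))
    <-> value (lift a) A0 ds.
    by apply: (leibniz_ext M_model) => //; exact: leibniz_prods_map_class.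
  by apply/ext_class/sub/ext_class.
Qed.

(** A class is determined by its representative, and this one has a tree as a
    name. *)
Lemma quotient_countable : countable_model quotient.
Proof.
move=> t; apply/countable_injP.
have code (X : qdom t) : exists T, gen T t = rep X := hull_rep X.
exists (fun X => pickle (sval (cid (code X)))) => X Y _ _ /(pcan_inj pickleK) E.
by apply: qdom_eq; rewrite -(svalP (cid (code X))) E (svalP (cid (code Y))).
Qed.

(** The value of the equality formula is that of [M], where it implies Leibniz
    equality of the representatives, hence equality of their classes. *)
Lemma quotient_normal : normal quotient.
Proof.
move=> t d d' a n n' m nn' x x' V; apply: qdom_eq.
apply: (@value_Eqt _ _ _ _ M_model (lift a) t n n' m) => //.
have LE : in_lang L (Lam x (Lam x' (Eqt m (Var K x) (Var K x')))) by exact: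
  (@in_lang_Eqt _ _ _ m t (Var K x) (Var K x')).
by move: V; rewrite quotient_value.
Qed.

Lemma quotient_refutes G : sequent_of L G -> refutes M G -> refutes quotient G.
Proof.
move=> LG [GL GR].
have sat f : sentence L f -> satisfies quotient f <-> satisfies M f.
  move=> [cf Lf]; have E (a : assignment qdom) (b : assignment M)
    : value b f = value (lift a) f.
    by congr ext; apply: (int_free M_intn) => // x; rewrite (negbTE (cf x)).
  split=> [[a]|[b Vf]].
    rewrite quotient_value // => Vf; exists (lift a).
    by apply/seteqP; split=> -[] // _; have : [set tt] tt by []; rewrite -{1}Vf.
  exists (fun x => class (default x.1)); rewrite quotient_value //.
  by rewrite -(E _ b) Vf; apply/seteqP; split=> -[].
by split=> f Gf; have Lf := LG _ Gf; rewrite sat //; [exact: GL|exact: GR].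
Qed.

End LowenheimSkolem.

(** * Refuting unprovable sequents *)

Lemma model_sublanguage (B : finType) (K : ty B -> Type) (L L' : set (const K))
    (M : structure K) :
  L `<=` L' -> intensional_model L' M -> intensional_model L M.
Proof.
move=> LL'; have sub t (A : term K t) : in_lang L A -> in_lang L' A.
  by move=> LA; exact: subset_trans LA LL'.
move=> [[Mvar Mfree Msubst] MBot MApp MLam MIncl]; split.
- split=> // [a a' t A /sub|a t A x N /sub LA /sub]; [exact: Mfree|exact: Msubst].
- exact: MBot.
- by move=> a t ts A A' /sub LA /sub; exact: MApp.
- by move=> a x ts A /sub; exact: MLam.
- by move=> a ts A A' /sub LA /sub; exact: MIncl.
Qed.

Theorem theorem6 (B : finType) (K : ty B -> Type) (L C : set (const K))
  (Lcountable : countable L) (Ccountable : countable C)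
  (LC_disjoint : L `&` C = set0)
  (C_denumerable : forall t : ty B, consts_of C t #= [set: nat])
  (P : set (sequent K))
  (P_provability : provability_property (L `|` C) P)
  (P_sound : sound (L `|` C) P)
  (Gamma : sequent K) (Gamma_L : sequent_of L Gamma) :
  ~ P Gamma ->
  exists M : structure K,
    [/\ intensional_model L M, countable_model M, normal M & refutes M Gamma].
Proof.
move=> nPGamma; pose LC := L `|` C.
have C_infinite t : infinite_set (consts_of C t).
  move=> finC; apply: infinite_nat; rewrite -(eq_finite_set (C_denumerable t)).
  exact: finC.
pose c0 t : K t := sval (cid (infinite_setN0 (C_infinite t))).
have c0_LC t : LC (Tagged K (c0 t)) by right;
  exact: (svalP (cid (infinite_setN0 (C_infinite t)))).
have Gamma_LC : sequent_of LC Gamma.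
  by move=> s /Gamma_L[cs Ls]; split=> //; exact: subset_trans Ls (@subsetUl _ L C).
(* No constant of C occurs in Gamma, so all of them are fresh at the start. *)
have Gamma_extensible : extensible L C P Gamma.
  split=> //; have -> : C `&` sconsts Gamma = set0; last exact: finite_set0.
  apply/seteqP; split=> // c [Cc [s /Gamma_L[_ Ls] /Ls Lc]].
  by rewrite -LC_disjoint.
have LC_countable : countable LC by rewrite /LC -bigcup2E;
  apply: bigcup_countable => [|[|[|n]] _] //; exact: countableP.
have [H [H_hintikka H_LC GammaH]] :=
  saturation P_provability C_infinite LC_countable Gamma_extensible.
have H_model := possible_model H_hintikka c0_LC.
have H_refutes := possible_refutes H_hintikka c0_LC H_LC.
have [e [_ e_surj]] := countable_enum (countable_terms LC_countable)
  (ex_intro _ (existT (term K) _ (Bot K)) (@sub0set _ LC)).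
have e_onto t (A : term K t) : in_lang LC A -> exists n, e n = existT (term K) t A.
  by move=> LA; exact: (e_surj (existT (term K) t A) LA).
exists (quotient (possible_structure H_hintikka c0_LC) e); split.
- apply: model_sublanguage (quotient_model H_model e_onto); by left.
- exact: quotient_countable.
- by move=> t d d' a n n' m; exact: (quotient_normal H_model e_onto).
- apply: (quotient_refutes H_model e_onto Gamma_LC); case: H_refutes => HL HR.
  by split=> f /GammaH; [exact: HL|exact: HR].
Qed.
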